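(* Let $S$ and $T$ be ultramatricial algebras over a semifield $F$. Then $(SK_0(S), \widehat{S}) \cong (SK_0(T), \widehat{T})$ (i.e. there is a group isomorphism $f\colon SK_0(S)\to SK_0(T)$ with $f(\widehat{S})=\widehat{T}$ and $f(SK_0(S)^+)=SK_0(T)^+$) if and only if $S \cong T$ as $F$-algebras.
   Context: A semiring $(S,+,\cdot,0,1)$ consists of a commutative monoid $(S,+,0)$ and a monoid $(S,\cdot,1)$ such that multiplication distributes over addition on both sides and $0s=0=s0$. A semifield is a commutative semiring $F$ with $(F\setminus\{0\},\cdot,1)$ a group. A (unital) $F$-algebra is an $F$-semimodule with an associative $F$-bilinear multiplication with identity element. A matricial $F$-algebra is an $F$-algebra isomorphic to $M_{n_1}(F)\times\cdots\times M_{n_r}(F)$ for some positive integers $n_1,\dots,n_r$. An $F$-algebra is ultramatricial if it is isomorphic to the direct limit, in the category of unital $F$-algebras, of a sequence $S_1\to S_2\to\cdots$ of matricial $F$-algebras. Right $S$-semimodules are commutative monoids with a unital, biadditive, associative right action of $S$ with $0_Ms=0_M=m0$. A finitely generated strongly projective right $S$-semimodule is one isomorphic to a direct summand of $S^n$ for some $n$. $SK_0(S)$ is the Grothendieck group of the commutative monoid of isomorphism classes of finitely generated strongly projective right $S$-semimodules under direct sum; $\widehat{P}$ denotes the class of $P$ in $SK_0(S)$. It is a pre-ordered abelian group with cone $SK_0(S)^+=\{\widehat{P}\mid P \text{ finitely generated strongly projective}\}$ (so $x\le y$ iff $y-x\in SK_0(S)^+$), with order-unit $\widehat{S}$. *)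

(* Defs.v *)
(* MathComp, with the classical axioms of mathcomp.classical.boolp. *)
From HB Require Import structures.
From mathcomp Require Import all_boot all_algebra.
From mathcomp Require Import boolp.

Set Implicit Arguments.
Unset Strict Implicit.
Unset Printing Implicit Defensive.

Import GRing.Theory.
Local Open Scope ring_scope.

(* comNzSemiRingType provides commutativity and 1 != 0.  Stability of F \ {0}
   under multiplication and inversion follows from the existence of
   inverses. *)
Definition semifield (F : comNzSemiRingType) : Prop :=
  forall x : F, x != 0 -> exists y : F, x * y = 1.

(** * Algebras

  A unital F-algebra is a semiAlgType F.  MathComp requires 1 != 0 there.  No
  generality is lost: matricial algebras are nonzero, hence so is the limit of
  a sequence of them (1 = 0 in the limit would already hold at some finite
  stage); and in the universal property of the limit the zero algebra is a
  trivial test object, having exactly one morphism to it from any algebra. *)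

Definition alg_iso (F : comNzSemiRingType) (A B : semiAlgType F) : Prop :=
  exists f : {lrmorphism A -> B}, bijective f.

(* matalg n [:: n2; ...; nr] is M_(n+1)(F) x (M_(n2+1)(F) x ...): sizes are
   shifted by one so that they are positive. *)
Fixpoint matalg (F : comNzSemiRingType) (n : nat) (s : seq nat) :
    semiAlgType F :=
  if s is m :: s' then ('M[F]_n.+1 * matalg F m s')%type else 'M[F]_n.+1.

Definition matricial (F : comNzSemiRingType) (A : semiAlgType F) : Prop :=
  exists (n : nat) (s : seq nat), alg_iso A (matalg F n s).

Definition cocone (F : comNzSemiRingType) (A : nat -> semiAlgType F)
    (f : forall i, {lrmorphism A i -> A i.+1})
    (L : semiAlgType F) (g : forall i, {lrmorphism A i -> L}) : Prop :=
  forall i (x : A i), g i.+1 (f i x) = g i x.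

Definition direct_limit (F : comNzSemiRingType) (A : nat -> semiAlgType F)
    (f : forall i, {lrmorphism A i -> A i.+1})
    (L : semiAlgType F) (g : forall i, {lrmorphism A i -> L}) : Prop :=
  cocone f g /\
  forall (B : semiAlgType F) (h : forall i, {lrmorphism A i -> B}),
    cocone f h ->
    exists u : {lrmorphism L -> B},
      (forall i (x : A i), u (g i x) = h i x) /\
      (forall v : {lrmorphism L -> B},
         (forall i (x : A i), v (g i x) = h i x) -> v =1 u).

Definition ultramatricial (F : comNzSemiRingType) (S : semiAlgType F) : Prop :=
  exists (A : nat -> semiAlgType F) (f : forall i, {lrmorphism A i -> A i.+1})
         (L : semiAlgType F) (g : forall i, {lrmorphism A i -> L}),
    [/\ forall i, matricial (A i), direct_limit f g & alg_iso S L].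

(** * Quotients by equivalence relations

  The isomorphism classes of S-semimodules do not live in the universe of the
  carriers of MathComp structures, so neither choiceType based quotients nor
  nmodType / zmodType are available for them.  For the same reason cmonoid and
  abgroup below are plain records. *)

Section Quotient.

Variables (T : Type) (e : T -> T -> Prop).

Definition quot : Type := {X : T -> Prop | exists x, X = e x}.

Definition qclass (x : T) : quot := exist _ (e x) (ex_intro _ x erefl).

Definition qrepr (X : quot) : T := projT1 (cid (svalP X)).

Lemma quot_inj (X Y : quot) : sval X = sval Y -> X = Y.
Proof.
case: X Y => [X hX] [Y hY] /= eXY; case: Y / eXY hY => hY.
by congr exist; apply: Prop_irrelevance.
Qed.

Lemma qreprK (X : quot) : qclass (qrepr X) = X.
Proof. by apply: quot_inj; rewrite /qrepr; case: cid. Qed.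

Hypothesis e_refl : forall x, e x x.
Hypothesis e_sym : forall x y, e x y -> e y x.
Hypothesis e_trans : forall x y z, e x y -> e y z -> e x z.

Lemma qclassP x y : qclass x = qclass y <-> e x y.
Proof.
split=> [[exy]|exy]; first by rewrite exy.
apply: quot_inj; apply/funext => z; apply/propext.
by split=> [exz|]; [apply: e_trans exz; apply: e_sym | apply: e_trans].
Qed.

Lemma qclassE (X : quot) : exists x, X = qclass x.
Proof. by exists (qrepr X); rewrite qreprK. Qed.

Lemma qrepr_class x : e (qrepr (qclass x)) x.
Proof. by apply/qclassP; rewrite qreprK. Qed.

End Quotient.

(** * Commutative monoids, abelian groups and the Grothendieck group *)

Record cmonoid := CMonoid {
  cm_car :> Type;
  cm0 : cm_car;
  cmD : cm_car -> cm_car -> cm_car;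
  cmDA : associative cmD;
  cmDC : commutative cmD;
  cm0D : left_id cm0 cmD }.

Record abgroup := AbGroup {
  ag_monoid :> cmonoid;
  agN : ag_monoid -> ag_monoid;
  agND : left_inverse (cm0 ag_monoid) agN (@cmD ag_monoid) }.

Arguments cm0 {_}.
Arguments cmD {_} _ _.
Arguments agN {_} _.

Section Grothendieck.

Variable M : cmonoid.

(* The pair (a, b) stands for the formal difference a - b. *)
Definition gr_rel (p q : M * M) : Prop :=
  exists k : M, cmD (cmD p.1 q.2) k = cmD (cmD q.1 p.2) k.

Lemma gr_refl p : gr_rel p p.
Proof. by exists cm0. Qed.

Lemma gr_sym p q : gr_rel p q -> gr_rel q p.
Proof. by case=> k hk; exists k. Qed.

Local Lemma cmCA (a b c : M) : cmD a (cmD b c) = cmD b (cmD a c).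
Proof. by rewrite cmDA (cmDC a) -cmDA. Qed.

Local Lemma cmACA (a b c d : M) :
  cmD (cmD a b) (cmD c d) = cmD (cmD a c) (cmD b d).
Proof. by rewrite -!cmDA (cmCA b). Qed.

Lemma gr_trans p q r : gr_rel p q -> gr_rel q r -> gr_rel p r.
Proof.
case: p q r => [a b] [c d] [x y] [k /= hk] [l /= hl].
exists (cmD (cmD c d) (cmD k l)) => /=.
transitivity (cmD (cmD (cmD a d) k) (cmD (cmD c y) l)).
  by rewrite (cmACA (cmD a d)) (cmDC c y) (cmACA a d) (cmDC d c) cmDA.
by rewrite hk hl (cmACA (cmD c b)) (cmDC c b) (cmACA b c) (cmDC b x) -[LHS]cmDA.
Qed.

Definition gr_add (p q : M * M) : M * M := (cmD p.1 q.1, cmD p.2 q.2).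
Definition gr_opp (p : M * M) : M * M := (p.2, p.1).

Lemma gr_add_compat p p' q q' :
  gr_rel p p' -> gr_rel q q' -> gr_rel (gr_add p q) (gr_add p' q').
Proof.
case=> k hk [l hl]; exists (cmD k l) => /=.
rewrite (cmACA p.1) (cmACA p'.1) (cmACA (cmD p.1 p'.2)) hk hl.
by rewrite (cmACA (cmD p'.1 p.2)).
Qed.

Lemma gr_opp_compat p p' : gr_rel p p' -> gr_rel (gr_opp p) (gr_opp p').
Proof. by case=> k hk; exists k; rewrite /= (cmDC p.2) (cmDC p'.2) hk. Qed.

Definition gr_type : Type := quot gr_rel.
Definition gr_class : M * M -> gr_type := @qclass _ gr_rel.
Definition gr0 : gr_type := gr_class (cm0, cm0).
Definition grD (x y : gr_type) : gr_type :=
  gr_class (gr_add (qrepr x) (qrepr y)).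
Definition grN (x : gr_type) : gr_type := gr_class (gr_opp (qrepr x)).

Lemma gr_classP p q : gr_class p = gr_class q <-> gr_rel p q.
Proof. exact: (qclassP gr_refl gr_sym gr_trans). Qed.

Lemma grDE p q : grD (gr_class p) (gr_class q) = gr_class (gr_add p q).
Proof.
apply/gr_classP; apply: gr_add_compat;
  exact: (qrepr_class gr_refl gr_sym gr_trans).
Qed.

Lemma grNE p : grN (gr_class p) = gr_class (gr_opp p).
Proof.
apply/gr_classP; apply: gr_opp_compat.
exact: (qrepr_class gr_refl gr_sym gr_trans).
Qed.

Lemma grDA : associative grD.
Proof.
move=> x y z; have [p ->] := qclassE x; have [q ->] := qclassE y.
have [r ->] := qclassE z; rewrite -!/(gr_class _) !grDE.
by rewrite /gr_add /= !cmDA.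
Qed.

Lemma grDC : commutative grD.
Proof.
move=> x y; have [p ->] := qclassE x; have [q ->] := qclassE y.
rewrite -!/(gr_class _) !grDE; congr (gr_class (_, _)); exact: cmDC.
Qed.

Lemma gr0D : left_id gr0 grD.
Proof.
move=> x; have [[a b] ->] := qclassE x; rewrite -!/(gr_class _) grDE.
by rewrite /gr_add /= !cm0D.
Qed.

Lemma grND : left_inverse gr0 grN grD.
Proof.
move=> x; have [[a b] ->] := qclassE x; rewrite -!/(gr_class _) grNE grDE.
apply/gr_classP; exists cm0; rewrite /=; congr (cmD _ cm0).
by rewrite (cmDC b) cmDC.
Qed.

Definition grothendieck : abgroup := @AbGroup (CMonoid grDA grDC gr0D) grN grND.

Definition gr_of (x : M) : grothendieck := gr_class (x, cm0).

End Grothendieck.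

(** * Finitely generated strongly projective right semimodules

  Right S-semimodules are left semimodules over the converse semiring S^c, so
  that the right action m a is written a *: m.  Accordingly 'rV[S^c]_n is the
  free right semimodule S^n, and S^c^o is S as a right semimodule. *)

Definition mod_iso (R : pzSemiRingType) (M N : lSemiModType R) : Prop :=
  exists f : {linear M -> N}, bijective f.

Definition strongly_projective_fg (S : pzSemiRingType) (P : lSemiModType S^c) :
    Prop :=
  exists (n : nat) (Q : lSemiModType S^c), mod_iso (P * Q)%type 'rV[S^c]_n.

Section ModIso.

Variable R : pzSemiRingType.
Implicit Types M N P Q : lSemiModType R.

Lemma mod_isoI M N (f : M -> N) (g : N -> M) :
  semilinear f -> cancel f g -> cancel g f -> mod_iso M N.
Proof.
move=> fL fK gK.
pose b := GRing.isSemilinear.Build R M N *:%R f fL.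
pose F : {linear M -> N} := HB.pack f b.
by exists F; exists g.
Qed.

Lemma mod_iso_refl M : mod_iso M M.
Proof. by apply: (@mod_isoI _ _ id id). Qed.

Lemma mod_iso_sym M N : mod_iso M N -> mod_iso N M.
Proof.
by case=> f [g fK gK]; apply: (mod_isoI (can2_semilinear fK gK) gK fK).
Qed.

Lemma mod_iso_trans M N P : mod_iso M N -> mod_iso N P -> mod_iso M P.
Proof.
by case=> f bf [g bg]; exists (g \o f : {linear M -> P}); apply: bij_comp.
Qed.

Lemma mod_iso_prod M M' N N' :
  mod_iso M M' -> mod_iso N N' -> mod_iso (M * N)%type (M' * N')%type.
Proof.
case=> f [f' fK f'K] [g [g' gK g'K]].
apply: (@mod_isoI _ _ (fun x => (f x.1, g x.2)) (fun x => (f' x.1, g' x.2))).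
- by split=> [a [x y]|[x y] [z t]]; congr (_, _) => /=;
    rewrite ?linearZ ?linearD.
- by case=> x y /=; rewrite fK gK.
- by case=> x y /=; rewrite f'K g'K.
Qed.

Lemma mod_iso_prodC M N : mod_iso (M * N)%type (N * M)%type.
Proof.
by apply: (@mod_isoI _ _ (fun x => (x.2, x.1)) (fun x => (x.2, x.1)));
  [split | case | case].
Qed.

Lemma mod_iso_prodA M N P :
  mod_iso (M * (N * P))%type ((M * N) * P)%type.
Proof.
by apply: (@mod_isoI (M * (N * P))%type ((M * N) * P)%type
  (fun x => ((x.1, x.2.1), x.2.2)) (fun x => (x.1.1, (x.1.2, x.2))));
  [split | case=> ? [] | case=> [] []].
Qed.

Lemma mod_iso_prod0 M : mod_iso ('rV[R]_0 * M)%type M.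
Proof.
apply: (@mod_isoI _ _ (fun x => x.2) (fun x => (0, x))) => //.
by case=> x y; rewrite (thinmx0 x).
Qed.

Lemma mod_iso_row m n : mod_iso ('rV[R]_m * 'rV[R]_n)%type 'rV[R]_(m + n).
Proof.
apply: (@mod_isoI _ _ (fun x => row_mx x.1 x.2)
  (fun x => (lsubmx x, rsubmx x))).
- by split=> [a x|x y]; rewrite ?scale_row_mx ?add_row_mx.
- by case=> x y /=; rewrite row_mxKl row_mxKr.
- by move=> x; apply: hsubmxK.
Qed.

Lemma mod_iso_regular : mod_iso R^o 'rV[R]_1.
Proof.
apply: (@mod_isoI R^o 'rV[R]_1 (fun a => \row__ a) (fun v => v 0 0)).
- by split=> [a x|x y]; apply/rowP => i; rewrite !mxE.
- by move=> a; rewrite mxE.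
- by move=> v; apply/rowP => i; rewrite mxE ord1.
Qed.

End ModIso.

Record fgsp (S : pzSemiRingType) := Fgsp {
  fgsp_mod :> lSemiModType S^c;
  fgspP : strongly_projective_fg fgsp_mod }.

Section SK0.

Variable S : pzSemiRingType.

Lemma sp_sum (P Q : lSemiModType S^c) :
  strongly_projective_fg P -> strongly_projective_fg Q ->
  @strongly_projective_fg S (P * Q)%type.
Proof.
case=> m [P' hP] [n [Q' hQ]]; exists (m + n)%N, (P' * Q')%type.
apply: mod_iso_trans (mod_iso_row _ _ _).
apply: mod_iso_trans (mod_iso_prod hP hQ).
apply: (@mod_isoI _ ((P * Q) * (P' * Q'))%type ((P * P') * (Q * Q'))%type
  (fun x => ((x.1.1, x.2.1), (x.1.2, x.2.2)))
  (fun x => ((x.1.1, x.2.1), (x.1.2, x.2.2)))).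
- by split.
- by case=> [[? ?] [? ?]].
- by case=> [[? ?] [? ?]].
Qed.

Lemma sp_zero : @strongly_projective_fg S 'rV[S^c]_0.
Proof. by exists 0%N, 'rV[S^c]_0; apply: mod_iso_prod0. Qed.

Lemma sp_regular : @strongly_projective_fg S S^c^o.
Proof.
exists 1%N, 'rV[S^c]_0; apply: mod_iso_trans (mod_iso_prodC _ _) _.
by apply: mod_iso_trans (mod_iso_prod0 _) _; apply: mod_iso_regular.
Qed.

Definition fgsp_sum (P Q : fgsp S) : fgsp S := Fgsp (sp_sum (fgspP P) (fgspP Q)).
Definition fgsp_zero : fgsp S := Fgsp sp_zero.
Definition fgsp_regular : fgsp S := Fgsp sp_regular.

Definition fgsp_iso (P Q : fgsp S) : Prop := mod_iso P Q.

Definition isocls_type : Type := quot fgsp_iso.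
Definition isocls : fgsp S -> isocls_type := @qclass _ fgsp_iso.
Definition isocls0 : isocls_type := isocls fgsp_zero.
Definition isoclsD (X Y : isocls_type) : isocls_type :=
  isocls (fgsp_sum (qrepr X) (qrepr Y)).

Lemma isoclsP P Q : isocls P = isocls Q <-> fgsp_iso P Q.
Proof.
apply: qclassP => [M|M N|M N L]; first exact: mod_iso_refl.
  exact: mod_iso_sym.
exact: mod_iso_trans.
Qed.

Lemma isoclsDE P Q : isoclsD (isocls P) (isocls Q) = isocls (fgsp_sum P Q).
Proof. by apply/isoclsP; apply: mod_iso_prod; apply/isoclsP; apply: qreprK. Qed.

Lemma isoclsDA : associative isoclsD.
Proof.
move=> X Y Z; have [P ->] := qclassE X; have [Q ->] := qclassE Y.
have [L ->] := qclassE Z; rewrite -!/(isocls _) !isoclsDE.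
by apply/isoclsP; apply: mod_iso_prodA.
Qed.

Lemma isoclsDC : commutative isoclsD.
Proof.
move=> X Y; have [P ->] := qclassE X; have [Q ->] := qclassE Y.
rewrite -!/(isocls _) !isoclsDE.
by apply/isoclsP; apply: mod_iso_prodC.
Qed.

Lemma isocls0D : left_id isocls0 isoclsD.
Proof.
move=> X; have [P ->] := qclassE X; rewrite -!/(isocls _) isoclsDE.
by apply/isoclsP; apply: mod_iso_prod0.
Qed.

Definition isocls_monoid : cmonoid := CMonoid isoclsDA isoclsDC isocls0D.

Definition SK0 : abgroup := grothendieck isocls_monoid.

Definition SK0_class (P : fgsp S) : SK0 := @gr_of isocls_monoid (isocls P).

Definition SK0_cone (x : SK0) : Prop := exists P : fgsp S, x = SK0_class P.

Definition SK0_unit : SK0 := SK0_class fgsp_regular.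

End SK0.

Definition SK0_iso (S T : pzSemiRingType) : Prop :=
  exists f : SK0 S -> SK0 T,
    [/\ {morph f : x y / cmD x y}, bijective f, f (SK0_unit S) = SK0_unit T &
        forall y : SK0 T, SK0_cone y <-> exists2 x : SK0 S, SK0_cone x & f x = y].

(* Main.v *)
(* The converse is functoriality: an isomorphism S -> T turns right S-modules
   into right T-modules.  For the direct implication, an ultramatricial algebra
   S is an increasing union of spans of systems of nonzero matrix units, and
   F acts on it without torsion.  Over a semifield F, a complemented idempotent
   of a product of matrix algebras is equivalent to a sum of diagonal matrix
   units, and is determined up to equivalence by its ranks in the blocks; when
   F is not a field this holds because F has no zero sums.  Hence finitely
   generated strongly projective modules over S cancel, their classes in SK0
   determine them, and an isomorphism f of pointed ordered groups transports
   decompositions of 1 into orthogonal idempotents.  A system of matrix units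
   of S therefore lifts to T with f preserving the classes of its diagonal, and
   two lifts with the same classes are conjugate by a unit.  Elliott's back and
   forth argument then builds compatible pairs of systems of the same type in S
   and T whose spans exhaust S and T, and the linear maps matching them glue to
   an isomorphism. *)
Require Import Defs.
From HB Require Import structures.
From mathcomp Require Import all_boot all_algebra.
From mathcomp Require Import perm generic_quotient boolp.

Set Implicit Arguments.
Unset Strict Implicit.
Unset Printing Implicit Defensive.

Import GRing.Theory.
Local Open Scope ring_scope.

(** The absence of subtraction shapes the argument. Lifting from [S] to [T] rests on uniqueness of
    coefficients: a relation between elements of a span is first read as a relation between
    coefficient matrices over [F], and then evaluated in other matrix units of the same type.
    Nonzero diagonal units together with the absence of torsion make this reading possible, and
    matrices over [S] are handled in the same way, as larger block diagonal matrices over [F].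
    Equality in [SK0] by itself only gives stable isomorphism. It is cancellation that turns equal
    classes back into equivalent idempotents, which is why it is settled before any lifting is
    attempted. *)

Section FunctionMatrices.

Variable R : pzSemiRingType.
Implicit Types I J K L : finType.

(** Matrices are functions on arbitrary finite types because sums, products and subtypes of index
    types all occur; no enumeration or cast of dimensions is then needed. *)
Definition fmul I J K (x : I -> J -> R) (y : J -> K -> R) : I -> K -> R :=
  fun i k => \sum_j x i j * y j k.

Definition fone I : I -> I -> R := fun i j => (i == j)%:R.

Definition fzero I J : I -> J -> R := fun _ _ => 0.

Definition fadd I J (x y : I -> J -> R) : I -> J -> R := fun i j => x i j + y i j.

(* x is block diagonal, c and d giving the block of each row and column index. *)
Definition supp I J (c : I -> nat) (d : J -> nat) (x : I -> J -> R) : Prop :=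
  forall i j, c i != d j -> x i j = 0.

Lemma eq2_fun (A B C : Type) (f g : A -> B -> C) : f =2 g -> f = g.
Proof. by move=> efg; apply/funext => a; apply/funext. Qed.

Lemma fmulA I J K L (x : I -> J -> R) (y : J -> K -> R) (z : K -> L -> R) :
  fmul x (fmul y z) = fmul (fmul x y) z.
Proof.
apply: eq2_fun => i l; rewrite /fmul.
under eq_bigr do rewrite mulr_sumr.
rewrite exchange_big; apply: eq_bigr => k _; rewrite mulr_suml.
by apply: eq_bigr => j _; rewrite mulrA.
Qed.

Lemma fmul1x I J (x : I -> J -> R) : fmul (@fone I) x = x.
Proof.
apply: eq2_fun => i j; rewrite /fmul /fone (bigD1 i) //= eqxx mul1r.
by rewrite big1 ?addr0 // => k; rewrite eq_sym => /negPf->; rewrite mul0r.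
Qed.

Lemma fmulx1 I J (x : I -> J -> R) : fmul x (@fone J) = x.
Proof.
apply: eq2_fun => i j; rewrite /fmul /fone (bigD1 j) //= eqxx mulr1.
by rewrite big1 ?addr0 // => k /negPf->; rewrite mulr0.
Qed.

Lemma fmulDl I J K (x y : I -> J -> R) (z : J -> K -> R) :
  fmul (fadd x y) z = fadd (fmul x z) (fmul y z).
Proof.
apply: eq2_fun => i j; rewrite /fmul /fadd -big_split /=.
by apply: eq_bigr => k _; rewrite mulrDl.
Qed.

Lemma fmulDr I J K (x : I -> J -> R) (y z : J -> K -> R) :
  fmul x (fadd y z) = fadd (fmul x y) (fmul x z).
Proof.
apply: eq2_fun => i j; rewrite /fmul /fadd -big_split /=.
by apply: eq_bigr => k _; rewrite mulrDr.
Qed.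

Lemma fmul0x I J K (y : J -> K -> R) : fmul (@fzero I J) y = @fzero I K.
Proof. by apply: eq2_fun => i k; rewrite /fmul big1 // => j _; rewrite mul0r. Qed.

Lemma fmulx0 I J K (x : I -> J -> R) : fmul x (@fzero J K) = @fzero I K.
Proof. by apply: eq2_fun => i k; rewrite /fmul big1 // => j _; rewrite mulr0. Qed.

Lemma faddx0 I J (x : I -> J -> R) : fadd x (@fzero I J) = x.
Proof. by apply: eq2_fun => i j; rewrite /fadd addr0. Qed.

Lemma supp_fmul I J K (c : I -> nat) (d : J -> nat) (b : K -> nat)
    (x : I -> J -> R) (y : J -> K -> R) :
  supp c d x -> supp d b y -> supp c b (fmul x y).
Proof.
move=> hx hy i k nik; rewrite /fmul big1 // => j _.
have [ecd|/hx->] := eqVneq (c i) (d j); last by rewrite mul0r.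
by rewrite hy ?mulr0 // -ecd.
Qed.

Lemma supp_fone I (c : I -> nat) : supp c c (@fone I).
Proof. by move=> i j; rewrite /fone; case: (eqVneq i j) => // ->; rewrite eqxx. Qed.

Lemma supp_fadd I J (c : I -> nat) (d : J -> nat) (x y : I -> J -> R) :
  supp c d x -> supp c d y -> supp c d (fadd x y).
Proof. by move=> hx hy i j nij; rewrite /fadd hx // hy // addr0. Qed.

End FunctionMatrices.

Arguments fone {R I}.
Arguments fzero {R I J}.

(** * Semifields: idempotents split, and invertible matrices are square *)

Section FieldCase.

Variable K : fieldType.

Definition mx_of (I J : finType) (x : I -> J -> K) : 'M[K]_(#|I|, #|J|) :=
  \matrix_(i, j) x (enum_val i) (enum_val j).

Lemma mx_of_mul (I J L : finType) (x : I -> J -> K) (y : J -> L -> K) :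
  mx_of (fmul x y) = mx_of x *m mx_of y.
Proof.
apply/matrixP => i l; rewrite !mxE /fmul big_enum_val /=.
by apply: eq_bigr => j _; rewrite !mxE.
Qed.

Lemma mx_of1 (I : finType) : mx_of (@fone K I) = 1%:M.
Proof. by apply/matrixP => i j; rewrite !mxE /fone (inj_eq enum_val_inj). Qed.

(* Some term of the Leibniz expansion of the determinant does not vanish. *)
Lemma field_transversal (I J : finType) (x : I -> J -> K) (y : J -> I -> K) :
  fmul x y = fone -> fmul y x = fone ->
  exists2 s : I -> J, injective s & forall i, x i (s i) != 0.
Proof.
move=> xy yx.
have mxy : mx_of x *m mx_of y = 1%:M by rewrite -mx_of_mul xy mx_of1.
have myx : mx_of y *m mx_of x = 1%:M by rewrite -mx_of_mul yx mx_of1.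
have eIJ : #|I| = #|J|.
  by apply/eqP; rewrite eqn_leq (mulmx1_min mxy) (mulmx1_min myx).
pose X : 'M[K]_#|I| := castmx (erefl, esym eIJ) (mx_of x).
have uX : X \in unitmx.
  have hc m n (e : n = m) (A : 'M[K]_(m, n)) (B : 'M[K]_(n, m)) :
      A *m B = 1%:M -> castmx (erefl, e) A \in unitmx.
    by case: m / e A B => A B /mulmx1_unit[].
  exact: hc mxy.
have : \det X != 0 by move: uX; rewrite unitmxE unitfE.
have [t nt _|h /negP[]] := pickP [pred t : 'S_(#|I|) | [forall i, X i (t i) != 0]];
    last first.
  apply/eqP; rewrite /determinant big1 // => t _.
  have /forallPn[i] := negbT (h t); rewrite negbK => /eqP Xi0.
  by rewrite (bigD1 i) //= Xi0 mul0r mulr0.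
pose s i := enum_val (cast_ord eIJ (t (enum_rank i))) : J.
exists s => [i j /enum_val_inj /cast_ord_inj /perm_inj /enum_rank_inj //|i].
move/forallP: nt => /(_ (enum_rank i)); rewrite castmxE mxE /= cast_ord_id.
by rewrite enum_rankK /s esymK.
Qed.

(* The rows of an idempotent p chosen by maxrankfun form a basis of its row
   space: if y is the matrix of these rows and p = x y, then y x y = y p = y
   gives y x = 1. *)
Lemma field_split (I : finType) (c : I -> nat) (p : I -> I -> K) :
  supp c c p -> fmul p p = p ->
  exists (L : finType) (f : L -> I) (x : I -> L -> K) (y : L -> I -> K),
    [/\ injective f, supp c (c \o f) x, supp (c \o f) c y,
        fmul x y = p & fmul y x = fone].
Proof.
move=> cp pp; pose P := mx_of p; pose g := maxrankfun P.
have PP : P *m P = P by rewrite -mx_of_mul pp.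
pose f := (fun k => enum_val (g k)) : 'I_(\rank P) -> I.
pose y k j := p (f k) j.
have [X PX] : exists X, P = X *m rowsub g P.
  by apply/submxP; rewrite eq_maxrowsub.
pose x i k := if c i == c (f k) then X (enum_rank i) k else 0.
have pE i j : p i j = \sum_k X (enum_rank i) k * y k j.
  have := congr1 (fun M : 'M[K]_#|I| => M (enum_rank i) (enum_rank j)) PX.
  rewrite !mxE !enum_rankK => ->; apply: eq_bigr => k _.
  by rewrite !mxE enum_rankK.
have xy_p : fmul x y = p.
  apply: eq2_fun => i j; rewrite /fmul.
  have [eij|nij] := eqVneq (c i) (c j); last first.
    rewrite cp // big1 // => k _; rewrite /x; case: eqVneq => [eik|].
      by rewrite /y cp ?mulr0 // -eik.
    by rewrite mul0r.
  rewrite pE; apply: eq_bigr => k _; rewrite /x.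
  case: eqVneq => // nik; rewrite /y cp ?mulr0 //.
  by rewrite -eij eq_sym.
have yp : fmul y p = y by apply: eq2_fun => k j; apply: (congr1 (fun q => q (f k) j) pp).
exists 'I_(\rank P), f, x, y; split=> //.
- by move=> k l /enum_val_inj /maxrankfun_inj.
- by move=> i k; rewrite /x => /negPf->.
- by move=> k j; apply: cp.
- have yE : rowsub g P = \matrix_(k, j) y k (enum_val j).
    by apply/matrixP => k j; rewrite !mxE.
  have : (\matrix_(k, l) fmul y x k l) *m rowsub g P = 1%:M *m rowsub g P.
    rewrite mul1mx yE; apply/matrixP => k j; rewrite !mxE.
    rewrite -[in RHS]yp -xy_p fmulA.
    by apply: eq_bigr => l _; rewrite !mxE.
  move/(row_free_inj (maxrowsub_free P))/matrixP => yx.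
  by apply: eq2_fun => k l; have := yx k l; rewrite !mxE.
Qed.
End FieldCase.

(* An equality of structures, so that statements about fields can be transported
   by rewriting. *)
Lemma semiring_field (F : comNzSemiRingType) : semifield F ->
  (exists m : F, 1 + m = 0) -> exists K : fieldType, F = K.
Proof.
case: F => F cF hF [m hm].
pose F0 : comNzSemiRingType := GRing.ComNzSemiRing.Pack cF.
have oppP : left_inverse 0 (fun x : F0 => m * x) +%R.
  by move=> x; rewrite -[x in _ + x]mul1r -mulrDl addrC hm mul0r.
pose z := GRing.Nmodule_isZmodule.Build F0 oppP.
pose F1 : comNzRingType := HB.pack F F0 z.
pose inv (x : F1) : F1 :=
  if pselect (x != 0) is left h then projT1 (cid (hF x h)) else 0.
have mulVf : forall x : F1, x != 0 -> inv x * x = 1.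
  move=> x nx; rewrite /inv; case: pselect => // h.
  by rewrite mulrC; case: cid.
have inv0 : inv 0 = 0.
  by rewrite /inv; case: pselect => // h; exfalso; rewrite eqxx in h.
pose fi := GRing.ComNzRing_isField.Build F1 mulVf inv0.
pose F2 : fieldType := HB.pack F F1 fi.
(* [F] was destructed at the start, so the semiring underlying [F2] reduces to the packed [F] and
   the equality holds by conversion. *)
by exists F2.
Qed.

Section Semifields.

Variables (F : comNzSemiRingType) (hF : semifield F).

Lemma semifield_mulf_eq0 (x y : F) : x * y = 0 -> x = 0 \/ y = 0.
Proof.
have [->|/hF[x' xx'] xy0] := eqVneq x 0; [by left|right].
by rewrite -[y]mul1r -xx' mulrC mulrA (mulrC y) xy0 mul0r.
Qed.

Lemma semifield_scale_inj (x y z : F) : z != 0 -> x * z = y * z -> x = y.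
Proof.
move=> /hF[z' zz'] e; rewrite -[x]mulr1 -zz' mulrA e.
by rewrite -mulrA zz' mulr1.
Qed.

Section ZeroSumFree.

Hypothesis noneg : ~ exists m : F, 1 + m = 0.

(** Dividing by a nonzero [x] would turn the equation into [1 + m = 0]. *)
Lemma zsf_addl (x y : F) : x + y = 0 -> x = 0.
Proof.
move=> xy0; apply/eqP; apply/negPn/negP => /hF[x' xx']; apply: noneg.
by exists (y * x'); rewrite -xx' -mulrDl xy0 mul0r.
Qed.

Lemma zsf_sum (I : finType) (G : I -> F) : \sum_i G i = 0 -> forall i, G i = 0.
Proof. by move=> sG i; move: sG; rewrite (bigD1 i) //= => /zsf_addl. Qed.

(** Let [s i] pick a nonzero term of the diagonal entry at [i]. If [s i = s k] with [i != k], the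
    off-diagonal entry at [i], [k] would contain a nonzero term, yet it vanishes and so do all its
    terms. *)
Lemma zsf_transversal (I J : finType) (x : I -> J -> F) (y : J -> I -> F) :
  fmul x y = fone ->
  exists2 s : I -> J, injective s & forall i, x i (s i) != 0.
Proof.
move=> xy.
have h i : exists j, (x i j != 0) && (y j i != 0).
  have : (fmul x y) i i != 0 by rewrite xy /fone eqxx oner_neq0.
  apply: contra_neqP => /forallNP h; rewrite /fmul big1 // => j _.
  have /negP := h j; rewrite negb_and !negbK => /orP[]/eqP->;
    by rewrite ?mul0r ?mulr0.
have [s hs] := choice h.
exists s => [i k eik|i]; last by case/andP: (hs i).
apply/eqP/negPn/negP => nik.
have : fmul x y i k = 0 by rewrite xy /fone (negPf nik).
move/zsf_sum => /(_ (s i)) /semifield_mulf_eq0[]/eqP.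
  by case/andP: (hs i) => /negPf->.
by rewrite eik; case/andP: (hs k) => _ /negPf->.
Qed.

(** Since [p + p'] is the identity, [p] is diagonal; since [p p' = 0], each diagonal entry is 0 or
    1. So [p] is the projection onto a subset [L] of the indices. *)
Lemma zsf_split (I : finType) (c : I -> nat) (p p' : I -> I -> F) :
  supp c c p -> fadd p p' = fone -> fmul p p' = fzero ->
  exists (L : finType) (f : L -> I) (x : I -> L -> F) (y : L -> I -> F),
    [/\ injective f, supp c (c \o f) x, supp (c \o f) c y,
        fmul x y = p & fmul y x = fone].
Proof.
move=> cp pp1 pp0.
have pd i j : i != j -> p i j = 0.
  move=> nij; have := congr1 (fun q => q i j) pp1.
  by rewrite /fadd /fone (negPf nij) => /zsf_addl.
have pi1 i : p i i != 0 -> p i i = 1.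
  move=> npi; have := congr1 (fun q => q i i) pp0.
  move/zsf_sum => /(_ i) /semifield_mulf_eq0[/eqP|p'0]; first by rewrite (negPf npi).
  by have := congr1 (fun q => q i i) pp1; rewrite /fadd p'0 addr0 /fone eqxx.
pose L := {i | p i i != 0}.
exists L, val, (fun i k => (i == val k)%:R), (fun k j => (val k == j)%:R).
split; first exact: val_inj.
- by move=> i k; case: (eqVneq i (val k)) => // ->; rewrite eqxx.
- by move=> k j; case: (eqVneq (val k) j) => // <-; rewrite eqxx.
- apply: eq2_fun => i j; rewrite /fmul.
  have [eij|nij] := eqVneq i j; last first.
    rewrite pd // big1 // => k _; case: (eqVneq i (val k)) => [<-|]; last first.
      by rewrite mul0r.
    by rewrite (negPf nij) mulr0.
  rewrite -eij; have [pi0|npi] := eqVneq (p i i) 0.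
    rewrite pi0 big1 // => k _; case: (eqVneq i (val k)) => [eik|]; last first.
      by rewrite mul0r.
    by have := valP k; rewrite /= -eik pi0 eqxx.
  rewrite pi1 // (bigD1 (Sub i npi : L)) //= eqxx mulr1 big1 ?addr0 // => k.
  by rewrite -val_eqE eq_sym /= => /negPf->; rewrite mul0r.
- apply: eq2_fun => k l; rewrite /fmul /fone (bigD1 (val k)) //= eqxx mul1r.
  rewrite big1 ?addr0 ?val_eqE // => j.
  by rewrite eq_sym => /negPf->; rewrite mul0r.
Qed.

End ZeroSumFree.

Lemma semifield_transversal (I J : finType) (x : I -> J -> F) (y : J -> I -> F) :
  fmul x y = fone -> fmul y x = fone ->
  exists2 s : I -> J, injective s & forall i, x i (s i) != 0.
Proof.
have [ng|/zsf_transversal h xy _] := EM (exists m : F, 1 + m = 0); last exact: h xy.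
have [K eK] := semiring_field hF ng; move: x y; rewrite eK => x y.
exact: field_transversal.
Qed.

(** The injection [f] records that the image of [p] has the size and the colours of a set of
    diagonal matrix units. *)
Lemma semifield_split (I : finType) (c : I -> nat) (p p' : I -> I -> F) :
  supp c c p -> fadd p p' = fone -> fmul p p' = fzero ->
  exists (L : finType) (f : L -> I) (x : I -> L -> F) (y : L -> I -> F),
    [/\ injective f, supp c (c \o f) x, supp (c \o f) c y,
        fmul x y = p & fmul y x = fone].
Proof.
move=> cp pp1 pp0.
have [ng|ng] := EM (exists m : F, 1 + m = 0); last exact: zsf_split pp1 pp0.
have pp : fmul p p = p.
  by rewrite -[RHS]fmulx1 -pp1 fmulDr pp0 faddx0.
have [K eK] := semiring_field hF ng.
move: p cp pp {p' pp1 pp0}; rewrite eK => p cp pp.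
exact: field_split.
Qed.

End Semifields.

(** * Equivalence of idempotents in products of matrix algebras over a semifield *)

Section ColouredEquivalence.

Variable F : comNzSemiRingType.
Implicit Types I J K L : finType.

(** Murray-von Neumann equivalence in the category of block diagonal matrices. The relations [feq],
    [mxeq] and [meq] are its analogues for other carriers. *)
Definition ceq I J (c : I -> nat) (d : J -> nat) (p : I -> I -> F)
    (q : J -> J -> F) : Prop :=
  exists (x : I -> J -> F) (y : J -> I -> F),
    [/\ supp c d x, supp d c y, fmul x y = p & fmul y x = q].

Definition ccpl I (c : I -> nat) (p : I -> I -> F) : Prop :=
  supp c c p /\ exists p', [/\ fadd p p' = fone, fmul p p' = fzero &
                               fmul p' p = fzero].

Lemma ccpl_idem I (c : I -> nat) p : ccpl c p -> fmul p p = p.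
Proof. by case=> _ [p' [p1 pp' _]]; rewrite -[RHS]fmulx1 -p1 fmulDr pp' faddx0. Qed.

Lemma ceq_sym I J (c : I -> nat) (d : J -> nat) p q : ceq c d p q -> ceq d c q p.
Proof. by case=> x [y [cx cy xy yx]]; exists y, x. Qed.

(** The factors are not cut down by the idempotents, so [(x z) (w y) = x q y = p p]; this is where
    idempotence enters. *)
Lemma ceq_trans I J K (c : I -> nat) (d : J -> nat) (b : K -> nat) p q r :
  fmul p p = p -> fmul r r = r -> ceq c d p q -> ceq d b q r -> ceq c b p r.
Proof.
move=> pp rr [x [y [cx cy xy yx]]] [z [w [cz cw zw wz]]].
exists (fmul x z), (fmul w y); split; try exact: supp_fmul cx cz.
- exact: supp_fmul cw cy.
- by rewrite fmulA -(fmulA x) zw -yx fmulA xy -fmulA xy.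
- by rewrite fmulA -(fmulA w) yx -zw fmulA wz -fmulA wz.
Qed.

Lemma fmul11 I : fmul fone fone = @fone F I.
Proof. exact: fmulx1. Qed.

(** The rank of the identity matrix in the block [k]. *)
Definition ncol I (c : I -> nat) (k : nat) : nat := \sum_i (c i == k).

Lemma ncolE I (c : I -> nat) k : ncol c k = #|[set i | c i == k]|.
Proof. by rewrite /ncol -sum1dep_card [RHS]big_mkcond. Qed.

Lemma ncol_codom I (c : I -> nat) k : ncol c k = count_mem k (codom c).
Proof.
rewrite /codom /image_mem count_map -sum1_count big_enum_cond big_mkcond.
by rewrite /=; apply: eq_bigr => i _; rewrite /=; case: (_ == _).
Qed.

Lemma ncol_sum I J (c : I -> nat) (d : J -> nat) k :
  ncol (fun u => match u with inl i => c i | inr j => d j end) k =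
  (ncol c k + ncol d k)%N.
Proof. exact: big_sumType. Qed.

Lemma ncol_inj I J (c : I -> nat) (d : J -> nat) (s : I -> J) k :
  injective s -> (forall i, d (s i) = c i) -> (ncol c k <= ncol d k)%N.
Proof.
move=> si ds; rewrite !ncolE -(card_imset _ si); apply: subset_leq_card.
by apply/subsetP => _ /imsetP[i + ->]; rewrite !inE ds.
Qed.

Hypothesis hF : semifield F.

(** A transversal of nonzero entries is an injection, and it preserves colours because entries
    between different colours vanish. Transversals in both directions give equality. *)
Lemma ceq1_ncol I J (c : I -> nat) (d : J -> nat) :
  ceq c d fone fone -> ncol c =1 ncol d.
Proof.
case=> x [y [cx cy xy yx]] k; apply/eqP; rewrite eqn_leq.
have [s si sn] := semifield_transversal hF xy yx.
have [t ti tn] := semifield_transversal hF yx xy.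
rewrite (ncol_inj k si) ?(ncol_inj k ti) // => i.
  by case: (eqVneq (d i) (c (t i))) => // ne; have := tn i; rewrite cy ?eqxx.
by case: (eqVneq (c i) (d (s i))) => // ne; have := sn i; rewrite cx ?eqxx.
Qed.

(** Equal counts make the two lists of colours permutations of each other; the resulting
    colour-preserving bijection [s] gives a permutation matrix and its transpose. *)
Lemma ncol_ceq1 I J (c : I -> nat) (d : J -> nat) :
  ncol c =1 ncol d -> ceq c d fone fone.
Proof.
move=> ecd; have pcd : perm_eq (codom c) (codom d).
  by apply/allP => k _; rewrite /= -!ncol_codom ecd.
have eIJ : #|I| = #|J|.
  by have := perm_size pcd; rewrite !size_codom.
have /tuple_permP[t et] : perm_eq (codom c) (codom_tuple d) by [].
pose s i := enum_val (t (cast_ord eIJ (enum_rank i))).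
have si : injective s.
  by move=> i j /enum_val_inj/perm_inj/cast_ord_inj/enum_rank_inj.
have ds i : d (s i) = c i.
  have := congr1 (fun l => nth 0%N l (enum_rank i)) et.
  rewrite /codom (nth_map i) -?cardE ?ltn_ord // nth_enum_rank => ->.
  rewrite (nth_map (cast_ord eIJ (enum_rank i))) ?size_enum_ord -?eIJ //.
  set j := cast_ord _ _; have -> : nth j (ord_tuple #|J|) (enum_rank i) = j.
    exact: (nth_ord_enum j j).
  rewrite (tnth_nth (d (s i))) /= /codom (nth_map (s i)) -?cardE ?ltn_ord //.
  by congr d; rewrite {1}/s -/j; apply: enum_val_nth.
pose x i j : F := (s i == j)%:R; pose y j i : F := (s i == j)%:R.
have supx i j : c i != d j -> (s i == j)%:R = 0 :> F.
  by case: (eqVneq (s i) j) => // <-; rewrite ds eqxx.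
exists x, y; split=> [|j i||]; first exact: supx.
- by rewrite eq_sym; apply: supx.
- apply: eq2_fun => i j; rewrite /fmul /x /y /fone (bigD1 (s i)) //= eqxx mul1r.
  rewrite (inj_eq si) eq_sym big1 ?addr0 // => k.
  by rewrite eq_sym => /negPf->; rewrite mul0r.
- have [t' _ t'K] := inj_card_bij si (eq_leq (esym eIJ)).
  apply: eq2_fun => i j; rewrite /fmul /x /y /fone (bigD1 (t' i)) //= t'K eqxx.
  rewrite mul1r big1 ?addr0 // => k nk; case: eqVneq => [e|]; last by rewrite mul0r.
  by case/eqP: nk; apply: si; rewrite t'K.
Qed.

Lemma ceq_split I (c : I -> nat) (p : I -> I -> F) : ccpl c p ->
  exists (L : finType) (f : L -> I), injective f /\ ceq c (c \o f) p fone.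
Proof.
case=> cp [p' [p1 pp' p'p]].
have [L [f [x [y [fi cx cy xy yx]]]]] := semifield_split hF cp p1 pp'.
by exists L, f; split=> //; exists x, y.
Qed.

(** The factorizations are put side by side. The cross terms vanish because [y = y p] and [z = q z],
    so that [y z = y p q z = 0], and likewise for [w x]. *)
Lemma ceq_add_fone I K L (c : I -> nat) (d : K -> nat) (b : L -> nat) p q :
  fmul p p = p -> fmul q q = q -> fmul p q = fzero -> fmul q p = fzero ->
  ceq c d p fone -> ceq c b q fone ->
  ceq c (fun u => match u with inl i => d i | inr j => b j end)
      (fadd p q) fone.
Proof.
move=> pp qq pq qp [x [y [cx cy xy yx]]] [z [w [cz cw zw wz]]].
have yz : fmul y z = fzero.
  rewrite -[y]fmul1x -yx -(fmulA y) xy -[z]fmulx1 -wz (fmulA z) zw.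
  by rewrite -fmulA (fmulA p) pq fmul0x fmulx0.
have wx : fmul w x = fzero.
  rewrite -[w]fmul1x -wz -(fmulA w) zw -[x]fmulx1 -yx (fmulA x) xy.
  by rewrite -fmulA (fmulA q) qp fmul0x fmulx0.
exists (fun i u => match u with inl k => x i k | inr l => z i l end).
exists (fun u i => match u with inl k => y k i | inr l => w l i end).
split=> [i [k|l]|[k|l] i||]; [exact: cx|exact: cz|exact: cy|exact: cw| |].
- by apply: eq2_fun => i j; rewrite /fmul big_sumType /= -xy -zw.
- apply: eq2_fun => -[k|l] [k'|l'].
  + by have := congr1 (fun m => m k k') yx.
  + by have := congr1 (fun m => m k l') yz.
  + by have := congr1 (fun m => m l k') wx.
  + by have := congr1 (fun m => m l l') wz.
Qed.

(* A coloured complemented idempotent is determined up to equivalence by its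
   rank in each colour, and these ranks are additive. *)
Lemma ceq_cancel I J (c : I -> nat) (d : J -> nat) p r q s :
  ccpl c p -> ccpl c r -> ccpl d q -> ccpl d s ->
  fmul p r = fzero -> fmul r p = fzero -> fmul q s = fzero -> fmul s q = fzero ->
  ceq c d (fadd p r) (fadd q s) -> ceq c d r s -> ceq c d p q.
Proof.
move=> hp hr hq hs pr rp qs sq prqs rs.
have [P' [fp [_ p1]]] := ceq_split hp; have [R' [fr [_ r1]]] := ceq_split hr.
have [Q' [fq [_ q1]]] := ceq_split hq; have [S' [fs [_ s1]]] := ceq_split hs.
move: (ccpl_idem hp) (ccpl_idem hq) (ccpl_idem hr) (ccpl_idem hs) => pp qq rr ss.
have pr1 := ceq_add_fone pp rr pr rp p1 r1.
have qs1 := ceq_add_fone qq ss qs sq q1 s1.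
have idD (X : finType) (a b : X -> X -> F) : fmul a a = a -> fmul b b = b ->
    fmul a b = fzero -> fmul b a = fzero -> fmul (fadd a b) (fadd a b) = fadd a b.
  move=> aa bb ab ba; rewrite fmulDl !fmulDr aa bb ab ba faddx0.
  by congr fadd; apply: eq2_fun => i j; rewrite /fadd add0r.
have e1 := ceq1_ncol (ceq_trans (fmul11 _) (fmul11 _) (ceq_sym pr1)
  (ceq_trans (idD _ _ _ pp rr pr rp) (fmul11 _) prqs qs1)).
have e2 := ceq1_ncol (ceq_trans (fmul11 _) (fmul11 _) (ceq_sym r1)
  (ceq_trans rr (fmul11 _) rs s1)).
(* Cancellation is reduced here to cancellation of natural numbers. *)
have e : ncol (c \o fp) =1 ncol (d \o fq).
  by move=> k; have := e1 k; rewrite !ncol_sum e2 => /addIn.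
exact: ceq_trans pp qq p1 (ceq_trans (fmul11 _) qq (ncol_ceq1 e) (ceq_sym q1)).
Qed.

End ColouredEquivalence.

(** * Systems of matrix units *)

Section MatrixUnits.

Variables (F : comNzSemiRingType) (S : semiAlgType F).

(* A system of matrix units of type M_(n1) x ... x M_(nr): the blocks are the
   colour classes of c, and e i j is set to 0 when i and j lie in different
   blocks. *)
Record musys (I : finType) (c : I -> nat) (e : I -> I -> S) : Prop := MuSys {
  mu_off : forall i j, c i != c j -> e i j = 0;
  mu_mul : forall i j k, c i = c j -> e i j * e j k = e i k;
  mu_orth : forall i j k l, j != k -> e i j * e k l = 0;
  mu_sum : \sum_i e i i = 1 }.

Definition lin (I : finType) (e : I -> I -> S) (x : I -> I -> F) : S :=
  \sum_i \sum_j x i j *: e i j.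

Definition mspan (I : finType) (c : I -> nat) (e : I -> I -> S) (z : S) : Prop :=
  exists2 x, supp c c x & z = lin e x.

(** A genuine condition over semifields: the nonnegative rationals act on the Boolean semiring with
    every nonzero scalar acting as the identity. *)
Definition torsion_free : Prop :=
  forall (a b : F) (z : S), z != 0 -> a *: z = b *: z -> a = b.

Lemma linD (I : finType) (e : I -> I -> S) x y :
  lin e (fadd x y) = lin e x + lin e y.
Proof.
rewrite /lin -big_split /=; apply: eq_bigr => i _; rewrite -big_split /=.
by apply: eq_bigr => j _; rewrite scalerDl.
Qed.

Lemma lin0 (I : finType) (e : I -> I -> S) : lin e fzero = 0.
Proof. by rewrite /lin big1 // => i _; rewrite big1 // => j _; rewrite scale0r. Qed.

Lemma linZ (I : finType) (e : I -> I -> S) a x :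
  lin e (fun i j => a * x i j) = a *: lin e x.
Proof.
rewrite /lin scaler_sumr; apply: eq_bigr => i _; rewrite scaler_sumr.
by apply: eq_bigr => j _; rewrite scalerA.
Qed.

Lemma lin_sum (I T : finType) (e : I -> I -> S) (x : T -> I -> I -> F) :
  lin e (fun i j => \sum_t x t i j) = \sum_t lin e (x t).
Proof.
rewrite /lin [RHS]exchange_big; apply: eq_bigr => i _; rewrite [RHS]exchange_big.
by apply: eq_bigr => j _; rewrite scaler_suml.
Qed.

Lemma lin_delta (I : finType) (e : I -> I -> S) i j :
  lin e (fun k l => (k == i)%:R * (l == j)%:R) = e i j.
Proof.
rewrite /lin (bigD1 i) //= (bigD1 j) //= !eqxx mulr1 scale1r.
rewrite big1 => [|l /negPf->]; last by rewrite mulr0 scale0r.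
rewrite addr0 big1 ?addr0 // => k /negPf-> /=; rewrite big1 // => l _.
by rewrite mul0r scale0r.
Qed.

Section System.

Variables (I : finType) (c : I -> nat) (e : I -> I -> S) (me : musys c e).

Lemma lin1 : lin e fone = 1.
Proof.
rewrite -(mu_sum me) /lin; apply: eq_bigr => i _; rewrite (bigD1 i) //=.
rewrite /fone eqxx scale1r big1 ?addr0 // => j.
by rewrite eq_sym => /negPf->; rewrite scale0r.
Qed.

Lemma linM x y : supp c c x -> lin e (fmul x y) = lin e x * lin e y.
Proof.
move=> cx; rewrite /lin mulr_suml; apply: eq_bigr => i _.
rewrite mulr_suml.
under eq_bigr => l _ do rewrite /fmul scaler_suml.
rewrite exchange_big; apply: eq_bigr => j _ /=.
have [cij|/cx->] := eqVneq (c i) (c j); last first.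
  by rewrite scale0r mul0r big1 // => l _; rewrite mul0r scale0r.
rewrite mulr_sumr [RHS](bigD1 j) //= [X in _ + X]big1 => [|k nkj]; last first.
  rewrite mulr_sumr big1 // => l _; rewrite -scalerAl -scalerAr.
  by rewrite (mu_orth me) ?scaler0 // eq_sym.
rewrite addr0 mulr_sumr; apply: eq_bigr => l _.
by rewrite -scalerAl -scalerAr (mu_mul me) // scalerA.
Qed.

Lemma mspan_mu i j : mspan c e (e i j).
Proof.
have [cij|/(mu_off me)->//] := eqVneq (c i) (c j); last first.
  by exists fzero => //; rewrite lin0.
exists (fun k l => (k == i)%:R * (l == j)%:R); last by rewrite lin_delta.
move=> k l; case: (eqVneq k i) => [->|]; last by rewrite mul0r.
by case: (eqVneq l j) => [->|]; rewrite ?mulr0 // cij eqxx.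
Qed.

Lemma mspanD x y : mspan c e x -> mspan c e y -> mspan c e (x + y).
Proof.
case=> a ca -> [b cb ->]; exists (fadd a b); last by rewrite linD.
exact: supp_fadd.
Qed.

Lemma mspan0 : mspan c e 0.
Proof. by exists fzero => //; rewrite lin0. Qed.

Lemma mspan_sum (T : finType) (g : T -> S) :
  (forall t, mspan c e (g t)) -> mspan c e (\sum_t g t).
Proof. by move=> h; elim/big_ind: _ => // [|x y]; [apply: mspan0|apply: mspanD]. Qed.

Lemma mspanZ a x : mspan c e x -> mspan c e (a *: x).
Proof.
case=> b cb ->; exists (fun i j => a * b i j); last by rewrite linZ.
by move=> i j nij; rewrite cb ?mulr0.
Qed.

(** Isolates a single coefficient; without torsion this makes coefficients unique. *)
Lemma mu_corner i j x : supp c c x -> c i = c j ->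
  e i i * lin e x * e j i = x i j *: e i i.
Proof.
move=> cx cij; rewrite /lin mulr_sumr (bigD1 i) //= [X in _ + X]big1.
  rewrite addr0 mulr_sumr mulr_suml (bigD1 j) //= [X in _ + X]big1.
    by rewrite addr0 -scalerAr -scalerAl !(mu_mul me).
  move=> l nlj; have [cil|/cx->] := eqVneq (c i) (c l); last first.
    by rewrite scale0r mulr0 mul0r.
  by rewrite -scalerAr -scalerAl (mu_mul me) // (mu_orth me) ?scaler0.
move=> k nki; rewrite mulr_sumr big1 // => l _.
by rewrite -scalerAr (mu_orth me) ?scaler0 // eq_sym.
Qed.

Lemma lin_inj x y : torsion_free -> (forall i, e i i != 0) ->
  supp c c x -> supp c c y -> lin e x = lin e y -> x = y.
Proof.
move=> tf nz cx cy exy; apply: eq2_fun => i j.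
have [cij|nij] := eqVneq (c i) (c j); last by rewrite cx ?cy.
by apply: (tf _ _ _ (nz i)); rewrite -!(mu_corner _ cij) // exy.
Qed.

(** The identification of matrices over a matrix algebra with larger matrices over [F]. The colour
    of a pair is that of its second component, so a product of matrix algebras yields block diagonal
    matrices again. *)
Definition flat (A B : finType) (X : A * I -> B * I -> F) : A -> B -> S :=
  fun a b => lin e (fun i j => X (a, i) (b, j)).

Notation snc := (fun u => c u.2).

Lemma flatM (A B D : finType) (X : A * I -> B * I -> F) (Y : B * I -> D * I -> F) :
  supp snc snc X -> flat (fmul X Y) = fmul (flat X) (flat Y).
Proof.
move=> cX; apply: eq2_fun => a d; rewrite [RHS]/fmul /flat.
transitivity (\sum_b lin e (fmul (fun i j => X (a, i) (b, j))
                                 (fun i j => Y (b, i) (d, j)))); last first.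
  by apply: eq_bigr => b _; apply: linM => i j; apply: (cX (a, i) (b, j)).
rewrite -lin_sum; congr lin; apply: eq2_fun => i j; rewrite /fmul.
by rewrite pair_big /=; apply: eq_bigr; case.
Qed.

Lemma flat1 (A : finType) : flat (@fone F (A * I)%type) = fone.
Proof.
apply: eq2_fun => a b; rewrite /flat /fone; have [->|nab] := eqVneq a b.
  rewrite -[RHS]lin1; congr lin; apply: eq2_fun => i j.
  by rewrite /fone xpair_eqE eqxx.
rewrite -[RHS](lin0 e); congr lin; apply: eq2_fun => i j.
by rewrite xpair_eqE (negPf nab).
Qed.

Lemma flat0 (A B : finType) : @flat A B fzero = fzero.
Proof. by apply: eq2_fun => a b; apply: lin0. Qed.

Lemma flatD (A B : finType) (X Y : A * I -> B * I -> F) :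
  flat (fadd X Y) = fadd (flat X) (flat Y).
Proof. by apply: eq2_fun => a b; rewrite [RHS]/fadd /flat -linD. Qed.

Lemma flat_inj (A B : finType) (X Y : A * I -> B * I -> F) :
  torsion_free -> (forall i, e i i != 0) ->
  supp snc snc X -> supp snc snc Y -> flat X = flat Y -> X = Y.
Proof.
move=> tf nz cX cY eXY; apply: eq2_fun => -[a i] [b j].
have := congr1 (fun f => f a b) eXY => /(lin_inj tf nz).
have sX (Z : A * I -> B * I -> F) : supp snc snc Z ->
    supp c c (fun i j => Z (a, i) (b, j)) by move=> cZ k l; apply: (cZ (a, k) (b, l)).
by move=> /(_ (sX _ cX) (sX _ cY)) /(congr1 (fun f => f i j)).
Qed.

Lemma flat_mspan (A B : finType) (P : A -> B -> S) :
  (forall a b, mspan c e (P a b)) -> exists2 X, supp snc snc X & P = flat X.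
Proof.
move=> hP; have hP' u : exists x, supp c c x /\ P u.1 u.2 = lin e x.
  by have [x] := hP u.1 u.2; exists x.
have [X hX] := choice hP'.
exists (fun u v => X (u.1, v.1) u.2 v.2).
  by move=> [a i] [b j] /=; apply: (hX (a, b)).1.
by apply: eq2_fun => a b; rewrite (hX (a, b)).2.
Qed.

End System.

End MatrixUnits.

(** * Cancellation in algebras filtered by matrix units *)

Definition fcpl (R : pzSemiRingType) (A : finType) (p : A -> A -> R) : Prop :=
  exists p', [/\ fadd p p' = fone, fmul p p' = fzero & fmul p' p = fzero].

Definition feq (R : pzSemiRingType) (A B : finType) (p : A -> A -> R)
    (q : B -> B -> R) : Prop :=
  exists (x : A -> B -> R) (y : B -> A -> R), fmul x y = p /\ fmul y x = q.

(** Stages are compared through their spans: a unit of one stage may be any combination of units of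
    the next. *)
Definition mu_filtration (F : comNzSemiRingType) (S : semiAlgType F) : Prop :=
  exists (I : nat -> finType) (c : forall m, I m -> nat)
         (e : forall m, I m -> I m -> S),
    [/\ forall m, musys (c m) (e m), forall m i, e m i i != 0,
        forall m z, mspan (c m) (e m) z -> mspan (c m.+1) (e m.+1) z
      & forall z, exists m, mspan (c m) (e m) z].

Definition eventually (P : nat -> Prop) : Prop :=
  exists m, forall k, (m <= k)%N -> P k.

Lemma eventuallyI P Q :
  eventually P -> eventually Q -> eventually (fun k => P k /\ Q k).
Proof.
move=> [m hm] [n hn]; exists (maxn m n) => k; rewrite geq_max => /andP[mk nk].
by split; [apply: hm | apply: hn].
Qed.

Lemma eventually_all (T : finType) (P : T -> nat -> Prop) :
  (forall t, eventually (P t)) -> eventually (fun k => forall t, P t k).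
Proof.
move=> /choice[m hm]; exists (\max_t m t) => k mk t; apply: hm.
exact: leq_trans (leq_bigmax t) mk.
Qed.

Lemma eventually_ex P : eventually P -> exists k, P k.
Proof. by case=> m hm; exists m; apply: hm. Qed.

Section Cancellation.

Variables (F : comNzSemiRingType) (S : semiAlgType F) (hF : semifield F).
Variable tf : torsion_free S.
Variables (I : nat -> finType) (c : forall m, I m -> nat).
Variable e : forall m, I m -> I m -> S.
Hypothesis me : forall m, musys (@c m) (@e m).
Hypothesis ne : forall m i, @e m i i != 0.
Hypothesis le : forall m z, mspan (@c m) (@e m) z -> mspan (@c m.+1) (@e m.+1) z.
Hypothesis se : forall z, exists m, mspan (@c m) (@e m) z.

Lemma eventually_mspan z : eventually (fun m => mspan (@c m) (@e m) z).
Proof.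
have [m hm] := se z; exists m => k /subnK <-.
by elim: (k - m)%N => // n; apply: le.
Qed.

Lemma eventually_flat (A B : finType) (P : A -> B -> S) :
  eventually (fun m => exists2 X,
    supp (fun u : A * I m => c u.2) (fun u : B * I m => c u.2) X &
    P = flat (@e m) X).
Proof.
have [m hm] : eventually (fun m => forall a b, mspan (@c m) (@e m) (P a b)).
  apply: eventually_all => a; apply: eventually_all => b.
  exact: eventually_mspan.
by exists m => k /hm h; have [X cX ->] := flat_mspan h; exists X.
Qed.

(** The twelve matrices involved have all their entries in one stage of the filtration. There [flat]
    is multiplicative and injective, which turns the claim into [ceq_cancel] over [F]. *)
Lemma filtered_cancel (A B : finType) (p r : A -> A -> S) (q s : B -> B -> S) :
  fcpl p -> fcpl r -> fcpl q -> fcpl s ->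
  fmul p r = fzero -> fmul r p = fzero -> fmul q s = fzero -> fmul s q = fzero ->
  feq (fadd p r) (fadd q s) -> feq r s -> feq p q.
Proof.
move=> [p' [p1 p2 p3]] [r' [r1 r2 r3]] [q' [q1 q2 q3]] [s' [s1 s2 s3]].
move=> pr rp qs sq [x [y [xy yx]]] [z [w [zw wz]]].
have ev := eventually_flat.
have /eventually_ex[m [[[[hp hp'] [hr hr']] [[hq hq'] [hs hs']]] [[hx hy] [hz hw]]]]
  := eventuallyI (eventuallyI (eventuallyI (eventuallyI (ev _ _ p) (ev _ _ p'))
                                           (eventuallyI (ev _ _ r) (ev _ _ r')))
                              (eventuallyI (eventuallyI (ev _ _ q) (ev _ _ q'))
                                           (eventuallyI (ev _ _ s) (ev _ _ s'))))
                 (eventuallyI (eventuallyI (ev _ _ x) (ev _ _ y))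
                              (eventuallyI (ev _ _ z) (ev _ _ w))).
pose a A := (fun u : A * I m => c u.2).
have inj (D E : finType) (X Y : D * I m -> E * I m -> F) :
    supp (a D) (a E) X -> supp (a D) (a E) Y -> flat (@e m) X = flat (@e m) Y ->
    X = Y.
  exact: (flat_inj (me m) tf (@ne m)).
have fM (D E G : finType) (X : D * I m -> E * I m -> F) (Y : E * I m -> G * I m -> F) :
    supp (a D) (a E) X -> flat (@e m) (fmul X Y) = fmul (flat (@e m) X) (flat (@e m) Y).
  exact: (flatM (me m)).
have f1 (D : finType) : flat (@e m) (@fone F (D * I m)%type) = fone.
  exact: (flat1 (me m)).
have s0 (D E : finType) : supp (a D) (a E) (@fzero F _ _) by [].
have inj0 (D E G : finType) (X : D * I m -> E * I m -> F) (Y : E * I m -> G * I m -> F) :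
    supp (a D) (a E) X -> supp (a E) (a G) Y ->
    fmul (flat (@e m) X) (flat (@e m) Y) = fzero -> fmul X Y = fzero.
  move=> cX cY h; apply: inj; [exact: supp_fmul cX cY|exact: s0|].
  by rewrite fM // flat0.
have cpl (D : finType) (X Y : D * I m -> D * I m -> F) :
    supp (a D) (a D) X -> supp (a D) (a D) Y ->
    fadd (flat (@e m) X) (flat (@e m) Y) = fone ->
    fmul (flat (@e m) X) (flat (@e m) Y) = fzero ->
    fmul (flat (@e m) Y) (flat (@e m) X) = fzero -> ccpl (a D) X.
  move=> cX cY h1 h2 h3; split=> //; exists Y; split; [|exact: inj0|exact: inj0].
  apply: inj; [exact: supp_fadd|exact: supp_fone|].
  by rewrite flatD f1.
have eqv (D E : finType) (P : D * I m -> D * I m -> F) (Q : E * I m -> E * I m -> F)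
    (X : D * I m -> E * I m -> F) (Y : E * I m -> D * I m -> F) :
    supp (a D) (a D) P -> supp (a E) (a E) Q ->
    supp (a D) (a E) X -> supp (a E) (a D) Y ->
    fmul (flat (@e m) X) (flat (@e m) Y) = flat (@e m) P ->
    fmul (flat (@e m) Y) (flat (@e m) X) = flat (@e m) Q -> ceq (a D) (a E) P Q.
  move=> cP cQ cX cY h1 h2; exists X, Y; split=> //; apply: inj => //.
  - exact: supp_fmul cX cY.
  - by rewrite fM.
  - exact: supp_fmul cY cX.
  - by rewrite fM.
case: hp hp' hr hr' => P cP eP [P' cP' eP'] [R cR eR] [R' cR' eR'].
case: hq hq' hs hs' => Q cQ eQ [Q' cQ' eQ'] [U cU eU] [U' cU' eU'].
case: hx hy hz hw => X cX eX [Y cY eY] [Z cZ eZ] [W cW eW].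
rewrite ?eP ?eP' in p1 p2 p3; rewrite ?eQ ?eQ' in q1 q2 q3.
rewrite ?eR ?eR' in r1 r2 r3; rewrite ?eU ?eU' in s1 s2 s3.
rewrite eP eR in pr rp; rewrite eQ eU in qs sq.
rewrite eX eY ?eP ?eR ?eQ ?eU in xy yx; rewrite eZ eW ?eR ?eU in zw wz.
rewrite eP eQ => {eP eQ}.
have [V [T [cV cT VT TV]]] : ceq (a A) (a B) P Q.
  have hP := cpl _ _ _ cP cP' p1 p2 p3; have hR := cpl _ _ _ cR cR' r1 r2 r3.
  have hQ := cpl _ _ _ cQ cQ' q1 q2 q3; have hU := cpl _ _ _ cU cU' s1 s2 s3.
  refine (ceq_cancel hF hP hR hQ hU _ _ _ _ _ _).
  - exact: inj0 pr.
  - exact: inj0 rp.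
  - exact: inj0 qs.
  - exact: inj0 sq.
  - apply: eqv cX cY _ _; try exact: supp_fadd; by rewrite flatD.
  - exact: eqv cZ cW _ _.
by exists (flat (@e m) V), (flat (@e m) T); rewrite -!fM // VT TV.
Qed.

End Cancellation.

(** * Modules and complemented idempotents *)

Section RowModules.

Variable R : pzSemiRingType.
Implicit Types P Q : lSemiModType R.

Definition mxeq m n (p : 'M[R]_m) (q : 'M[R]_n) : Prop :=
  exists (x : 'M[R]_(m, n)) (y : 'M[R]_(n, m)), x *m y = p /\ y *m x = q.

(* Over a semiring an idempotent p need not have a complement 1 - p; direct
   summands of free modules correspond to the idempotents that do. *)
Definition mxcpl n (p : 'M[R]_n) : Prop :=
  exists p', [/\ p + p' = 1%:M, p *m p' = 0 & p' *m p = 0].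

Lemma mxcpl_idem n (p : 'M[R]_n) : mxcpl p -> p *m p = p.
Proof. by case=> p' [p1 pp' _]; rewrite -[RHS]mulmx1 -p1 mulmxDr pp' addr0. Qed.

Lemma mxeq_sym m n (p : 'M[R]_m) (q : 'M[R]_n) : mxeq p q -> mxeq q p.
Proof. by case=> x [y [xy yx]]; exists y, x. Qed.

Lemma mxeq_trans m n k (p : 'M[R]_m) (q : 'M[R]_n) (r : 'M[R]_k) :
  p *m p = p -> r *m r = r -> mxeq p q -> mxeq q r -> mxeq p r.
Proof.
move=> pp rr [x [y [xy yx]]] [z [w [zw wz]]]; exists (x *m z), (w *m y); split.
  by rewrite mulmxA -(mulmxA x) zw -yx mulmxA xy -mulmxA xy.
by rewrite mulmxA -(mulmxA w) yx -zw mulmxA wz -mulmxA wz.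
Qed.

(** Cancellation of a common summand from modules, phrased with idempotents so that it can be
    verified in a stage of a filtration: [p] and [q] stand for the modules, [r] and [s] for two
    copies of the summand. *)
Definition stably_cancellative : Prop :=
  forall m n (p r : 'M[R]_m) (q s : 'M[R]_n),
    mxcpl p -> mxcpl r -> mxcpl q -> mxcpl s ->
    p *m r = 0 -> r *m p = 0 -> q *m s = 0 -> s *m q = 0 ->
    mxeq (p + r) (q + s) -> mxeq r s -> mxeq p q.

(** Exhibits [P] as the image of [e] acting on rows. *)
Definition mxrep P n (e : 'M[R]_n) : Prop :=
  exists (i : {linear P -> 'rV[R]_n}) (j : {linear 'rV[R]_n -> P}),
    cancel i j /\ forall v, i (j v) = v *m e.

Lemma eq_mulmx_row m n (A B : 'M[R]_(m, n)) :
  (forall v : 'rV_m, v *m A = v *m B) -> A = B.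
Proof. by move=> h; apply/row_matrixP => i; rewrite !rowE h. Qed.

Lemma mod_iso_inv P Q : mod_iso P Q ->
  exists (f : {linear P -> Q}) (g : {linear Q -> P}), cancel f g /\ cancel g f.
Proof.
case=> f [g fK gK]; pose b := GRing.isSemilinear.Build R Q P *:%R g
  (can2_semilinear fK gK).
by pose G : {linear Q -> P} := HB.pack g b; exists f, G.
Qed.

Lemma mxrep_eq P Q m n (e : 'M[R]_m) (f : 'M[R]_n) :
  mxrep P e -> mxrep Q f -> mod_iso P Q -> mxeq e f.
Proof.
move=> [i [j [iK jK]]] [k [l [kK lK]]] /mod_iso_inv[g [h [gK hK]]].
exists (lin1_mx (k \o g \o j)), (lin1_mx (i \o h \o l)).
split; apply: eq_mulmx_row => v; rewrite mulmxA !mul_rV_lin1 /=.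
  by rewrite kK gK jK.
by rewrite iK hK lK.
Qed.

Lemma mxrep_iso P Q m n (e : 'M[R]_m) (f : 'M[R]_n) :
  mxrep P e -> mxrep Q f -> mxeq e f -> mod_iso P Q.
Proof.
move=> [i [j [iK jK]]] [k [l [kK lK]]] [x [y [xy yx]]].
have je v : j (v *m e) = j v by rewrite -jK iK.
have lf v : l (v *m f) = l v by rewrite -lK kK.
apply: (@mod_isoI _ _ _ (fun a => l (i a *m x)) (fun b => j (k b *m y))).
- split=> [a u|u w]; first by rewrite !linearZ /= -scalemxAl linearZ.
  by rewrite linearD mulmxDl linearD.
- by move=> a; rewrite lK -yx -!mulmxA xy (mulmxA x) xy mulmxA !je iK.
- by move=> b; rewrite jK -xy -!mulmxA yx (mulmxA y) yx mulmxA !lf kK.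
Qed.

Lemma mxrep_prod P Q m n (e : 'M[R]_m) (f : 'M[R]_n) :
  mxrep P e -> mxrep Q f -> mxrep (P * Q)%type (block_mx e 0 0 f).
Proof.
move=> [i [j [iK jK]]] [k [l [kK lK]]].
pose I (u : (P * Q)%type) : 'rV[R]_(m + n) := row_mx (i u.1) (k u.2).
pose J (v : 'rV[R]_(m + n)) : (P * Q)%type := (j (lsubmx v), l (rsubmx v)).
have IL : semilinear I.
  by split=> [a u|u v]; rewrite /I !(linearZ, linearD) /= (scale_row_mx, add_row_mx).
have JL : semilinear J.
  by split=> [a u|u v]; rewrite /J !(linearZ, linearD).
pose bI := GRing.isSemilinear.Build R _ _ *:%R I IL.
pose bJ := GRing.isSemilinear.Build R _ _ *:%R J JL.
pose LI : {linear (P * Q)%type -> 'rV[R]_(m + n)} := HB.pack I bI.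
pose LJ : {linear 'rV[R]_(m + n) -> (P * Q)%type} := HB.pack J bJ.
exists LI, LJ; split=> [[u v]|v] /=; rewrite /I /J /=.
  by rewrite row_mxKl row_mxKr iK kK.
by rewrite jK lK -{3}[v]hsubmxK mul_row_block !mulmx0 add0r addr0.
Qed.

Lemma block_mx_sum m n (e : 'M[R]_m) (f : 'M[R]_n) :
  block_mx e 0 0 f = block_mx e 0 0 0 + block_mx 0 0 0 f.
Proof. by rewrite add_block_mx !addr0 !add0r. Qed.

Lemma mxcpl_block m n (e : 'M[R]_m) (f : 'M[R]_n) :
  mxcpl e -> mxcpl f -> mxcpl (block_mx e 0 0 f).
Proof.
case=> e' [e1 ee' e'e] [f' [f1 ff' f'f]]; exists (block_mx e' 0 0 f').
rewrite add_block_mx !mulmx_block e1 f1 !addr0 !mulmx0 !mul0mx ee' e'e ff' f'f.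
by rewrite !addr0 -scalar_mx_block block_mx0.
Qed.

Lemma mxcpl0 n : mxcpl (0 : 'M[R]_n).
Proof. by exists 1%:M; rewrite add0r mulmx1 mul1mx. Qed.

Lemma mxeq_block0 m n (e : 'M[R]_m) : e *m e = e ->
  mxeq e (block_mx e 0 0 (0 : 'M[R]_n)).
Proof.
move=> ee; exists (row_mx e 0), (col_mx e 0).
by rewrite mul_row_col mul_col_row ee !mulmx0 !mul0mx addr0.
Qed.

End RowModules.

Section FixedRows.

Variables (R : pzSemiRingType) (n : nat) (e : 'M[R]_n).

(** For idempotent [e] this is the image of [e]. Being fixed is an equation on [v], so the image
    becomes a subtype whose structures do not mention the proof of idempotence. *)
Definition fixed_rows : {pred 'rV[R]_n} := fun v => v *m e == v.

Fact fixed_rows_closed : subsemimod_closed fixed_rows.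
Proof.
split=> [|a v /eqP hv]; last by rewrite unfold_in -scalemxAl hv.
split=> [|u v /eqP hu /eqP hv]; first by rewrite unfold_in mul0mx.
by rewrite unfold_in mulmxDl hu hv.
Qed.

HB.instance Definition _ :=
  GRing.isSubSemiModClosed.Build R 'rV[R]_n fixed_rows fixed_rows_closed.

Record imod : Type := IMod { imod_val :> 'rV[R]_n; _ : imod_val \in fixed_rows }.

HB.instance Definition _ := [isSub for imod_val].
HB.instance Definition _ := [Choice of imod by <:].
HB.instance Definition _ := [SubChoice_isSubLSemiModule of imod by <:].

Hypothesis ee : e *m e = e.

Lemma mul_fixed_rows v : v *m e \in fixed_rows.
Proof. by rewrite unfold_in -mulmxA ee. Qed.

Definition imod_proj (v : 'rV[R]_n) : imod := IMod (mul_fixed_rows v).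

Lemma imod_proj_semilinear : semilinear imod_proj.
Proof.
by split=> [a v|u v]; apply: val_inj; rewrite /= ?scalemxAl ?mulmxDl.
Qed.

Lemma imod_valK : cancel imod_val imod_proj.
Proof. by case=> v hv; apply: val_inj; rewrite /=; apply/eqP. Qed.

Lemma mxrep_imod : mxrep imod e.
Proof.
pose b := GRing.isSemilinear.Build R _ _ *:%R imod_proj imod_proj_semilinear.
pose J : {linear 'rV[R]_n -> imod} := HB.pack imod_proj b.
by exists (val : {linear imod -> 'rV[R]_n}), J; split=> //; apply: imod_valK.
Qed.

End FixedRows.

(** * Complemented idempotents and their classes in [SK0] *)

Section ClassesOfIdempotents.

Variable S : pzSemiRingType.

Definition meq (p q : S) : Prop := exists x y : S, x * y = p /\ y * x = q.

Definition cidem (p : S) : Prop :=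
  exists p', [/\ p + p' = 1, p * p' = 0 & p' * p = 0].

Definition mx1 (p : S) : 'M[S^c]_1 := (p : S^c)%:M.

(* The order is reversed because right modules are modules over S^c. *)
Lemma mx1M p q : mx1 p *m mx1 q = mx1 (q * p).
Proof. by rewrite /mx1 -scalar_mxM. Qed.

Lemma mx1D p q : mx1 p + mx1 q = mx1 (p + q).
Proof. by rewrite /mx1 -raddfD. Qed.

Lemma mx1_0 : mx1 0 = 0.
Proof. exact: raddf0. Qed.

Lemma mx1K p : mx1 p 0 0 = p.
Proof. by rewrite mxE eqxx mulr1n. Qed.

Lemma mx1_inj : injective mx1.
Proof. by move=> p q e; rewrite -[p]mx1K e mx1K. Qed.

Lemma mx1E (A : 'M[S^c]_1) : A = mx1 (A 0 0).
Proof. exact: mx11_scalar. Qed.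

Lemma cidem_mul p : cidem p -> p * p = p.
Proof. by case=> p' [p1 pp' _]; rewrite -[RHS]mulr1 -p1 mulrDr pp' addr0. Qed.

Lemma cidem1 : cidem 1.
Proof. by exists 0; rewrite addr0 mulr0 mul0r. Qed.

Lemma meq_sym p q : meq p q -> meq q p.
Proof. by case=> x [y [xy yx]]; exists y, x. Qed.

Lemma meq0 p : p * p = p -> meq p 0 -> p = 0.
Proof.
move=> pp [x [y [xy yx]]]; rewrite -pp -xy -mulrA (mulrA y) yx.
by rewrite mul0r mulr0.
Qed.

(** From [x q = p x] and [y p = q y], replacing [x] by [p x] and [y] by [q y] keeps both products
    and places the factors in the corners of [p] and [q]. *)
Lemma meq_cut p q : p * p = p -> q * q = q -> meq p q ->
  exists x y, [/\ x * y = p, y * x = q, p * x = x /\ x * q = x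
                & q * y = y /\ y * p = y].
Proof.
move=> pp qq [x [y [xy yx]]].
have xq : x * q = p * x by rewrite -yx mulrA xy.
have yp : y * p = q * y by rewrite -xy mulrA yx.
exists (p * x), (q * y).
rewrite -!mulrA xq yp (mulrA x) xq (mulrA y) yp -!mulrA xy yx !mulrA !pp !qq.
by [].
Qed.

Lemma meq_mx1 p q : meq p q <-> mxeq (mx1 p) (mx1 q).
Proof.
split=> [[x [y [xy yx]]]|[x [y []]]].
  by exists (mx1 y), (mx1 x); rewrite !mx1M xy yx.
rewrite (mx1E x) (mx1E y) !mx1M => /mx1_inj xy /mx1_inj yx.
by exists (y 0 0), (x 0 0).
Qed.

Lemma cidem_mx1 p : cidem p <-> mxcpl (mx1 p).
Proof.
split=> [[p' [p1 pp' p'p]]|[P' []]].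
  by exists (mx1 p'); rewrite mx1D p1 !mx1M pp' p'p mx1_0.
rewrite (mx1E P') mx1D !mx1M -mx1_0 => /mx1_inj p1 /mx1_inj pp' /mx1_inj p'p.
by exists (P' 0 0).
Qed.

(** The projections of the free module onto [P] and onto its complementary summand are the
    idempotent and its complement. *)
Lemma fgsp_mxrep (P : fgsp S) : exists n (e : 'M[S^c]_n), mxcpl e /\ mxrep P e.
Proof.
have [n [Q /mod_iso_inv[f [g [fK gK]]]]] := fgspP P.
pose i1 (u : P) : (P * Q)%type := (u, 0).
pose i2 (u : Q) : (P * Q)%type := (0, u).
have i1L : semilinear i1.
  by split=> [a u|u v]; rewrite /i1; congr pair; rewrite /= ?scaler0 ?addr0.
have i2L : semilinear i2.
  by split=> [a u|u v]; rewrite /i2; congr pair; rewrite /= ?scaler0 ?addr0.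
pose b1 := GRing.isSemilinear.Build _ _ _ *:%R i1 i1L.
pose b2 := GRing.isSemilinear.Build _ _ _ *:%R i2 i2L.
pose I1 : {linear P -> (P * Q)%type} := HB.pack i1 b1.
pose I2 : {linear Q -> (P * Q)%type} := HB.pack i2 b2.
pose J1 : {linear (P * Q)%type -> P} := fst.
pose J2 : {linear (P * Q)%type -> Q} := snd.
exists n, (lin1_mx (f \o I1 \o J1 \o g)); split.
  exists (lin1_mx (f \o I2 \o J2 \o g)).
  split; apply: eq_mulmx_row => v;
    rewrite ?mulmxDr ?mulmxA !mul_rV_lin1 ?mulmx1 ?mulmx0 /=.
  - rewrite -linearD -[RHS]gK; congr (f _).
    by case: (g v) => a b; rewrite /i1 /i2; congr pair; rewrite /= ?addr0 ?add0r.
  - by rewrite fK /i2 /= -[RHS](linear0 f).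
  - by rewrite fK /i1 /= -[RHS](linear0 f).
exists (f \o I1 : {linear P -> 'rV_n}), (J1 \o g : {linear 'rV_n -> P}).
by split=> [u|v]; rewrite ?mul_rV_lin1 /= ?fK.
Qed.

Lemma mxcpl_fgsp n (e : 'M[S^c]_n) : mxcpl e -> exists P : fgsp S, mxrep P e.
Proof.
move=> ce; have [e' [e1 ee' e'e]] := ce.
have ee := mxcpl_idem ce.
have ee2 : e' *m e' = e' by rewrite -[RHS]mulmx1 -e1 mulmxDr e'e add0r.
suff h : @strongly_projective_fg S (imod e).
  by exists (Fgsp h); apply: mxrep_imod.
exists n, (imod e').
apply: (@mod_isoI _ (imod e * imod e')%type _ (fun u => val u.1 + val u.2)
  (fun v => (imod_proj ee v, imod_proj ee2 v))).
- by split=> [a u|u v] /=; rewrite ?scalerDr // addrACA.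
- case=> -[u hu] [v hv]; congr pair; apply: val_inj => /=.
    rewrite mulmxDl -[in v *m e](eqP hv) -mulmxA e'e mulmx0 addr0.
    exact/eqP.
  rewrite mulmxDl -[in u *m e'](eqP hu) -mulmxA ee' mulmx0 add0r.
  exact/eqP.
- by move=> v /=; rewrite -mulmxDr e1 mulmx1.
Qed.

Lemma SK0_classD (P Q : fgsp S) :
  SK0_class (fgsp_sum P Q) = cmD (SK0_class P) (SK0_class Q).
Proof.
rewrite /SK0_class /gr_of [RHS]grDE /gr_add /=.
by rewrite isoclsDE isocls0D.
Qed.

Lemma SK0_class0 : SK0_class (fgsp_zero S) = cm0.
Proof. by []. Qed.

Lemma SK0_class_iso (P Q : fgsp S) : mod_iso P Q -> SK0_class P = SK0_class Q.
Proof. by move=> h; congr gr_of; apply/isoclsP. Qed.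

(** Equal classes mean that [P] and [Q] become isomorphic after adding some [K]. In block diagonal
    representatives the idempotent [g] of [K] is an orthogonal summand on both sides, and
    cancellation removes it. *)
Lemma SK0_class_inj (P Q : fgsp S) : stably_cancellative S^c ->
  SK0_class P = SK0_class Q -> mod_iso P Q.
Proof.
move=> sc /gr_classP[k /=].
have [K ->] := qclassE k; rewrite -/(isocls K) -/(isocls0 S).
rewrite ![isoclsD _ (isocls0 S)]isoclsDC !isocls0D !isoclsDE => /isoclsP h.
have [m [e [ce eP]]] := fgsp_mxrep P; have [n [f [cf fQ]]] := fgsp_mxrep Q.
have [l [g [cg gK]]] := fgsp_mxrep K.
apply: (mxrep_iso eP fQ).
have ee := mxcpl_idem ce; have ff := mxcpl_idem cf; have gg := mxcpl_idem cg.
have h1 := mxrep_eq (mxrep_prod eP gK) (mxrep_prod fQ gK) h.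
rewrite (block_mx_sum e g) (block_mx_sum f g) in h1.
apply: (mxeq_trans ee ff (mxeq_block0 l ee)).
have idb k1 k2 (a : 'M[S^c]_k1) : a *m a = a ->
    (fun b : 'M[S^c]_(k1 + k2) => b *m b = b) (block_mx a 0 0 0).
  by move=> aa; rewrite mulmx_block aa !mulmx0 !mul0mx !addr0.
refine (mxeq_trans (idb _ l _ ee) ff _ (mxeq_sym (mxeq_block0 l ff))).
apply: sc h1 _; try by apply: mxcpl_block => //; apply: mxcpl0.
- by rewrite mulmx_block !mulmx0 !mul0mx !addr0 block_mx0.
- by rewrite mulmx_block !mulmx0 !mul0mx !addr0 block_mx0.
- by rewrite mulmx_block !mulmx0 !mul0mx !addr0 block_mx0.
- by rewrite mulmx_block !mulmx0 !mul0mx !addr0 block_mx0.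
- exists (block_mx 0 0 0 g), (block_mx 0 0 0 g).
  by rewrite !mulmx_block !mulmx0 !mul0mx !add0r gg.
Qed.

(* The class of p S; junk value 0 unless p is an idempotent for which p S is
   finitely generated strongly projective. *)
Definition idem_class (p : S) : SK0 S :=
  if pselect (exists P : fgsp S, mxrep P (mx1 p)) is left h
  then SK0_class (projT1 (cid h)) else cm0.

Lemma idem_classE p : cidem p ->
  exists P : fgsp S, mxrep P (mx1 p) /\ idem_class p = SK0_class P.
Proof.
move=> /cidem_mx1/mxcpl_fgsp h; rewrite /idem_class; case: pselect => // h'.
by exists (projT1 (cid h')); split=> //; case: cid.
Qed.

Lemma idem_class_rep p (P : fgsp S) : cidem p -> mxrep P (mx1 p) ->
  idem_class p = SK0_class P.
Proof.
move=> cp hP; have [Q [hQ ->]] := idem_classE cp; apply: SK0_class_iso.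
apply: mxrep_iso hQ hP _; exists (mx1 p), (mx1 p).
by rewrite mx1M cidem_mul.
Qed.

Lemma idem_class_meq p q : cidem p -> cidem q -> meq p q ->
  idem_class p = idem_class q.
Proof.
move=> cp cq /meq_mx1 pq; have [P [hP ->]] := idem_classE cp.
have [Q [hQ ->]] := idem_classE cq; apply: SK0_class_iso.
exact: mxrep_iso hP hQ pq.
Qed.

Lemma idem_class_inj p q : stably_cancellative S^c -> cidem p -> cidem q ->
  idem_class p = idem_class q -> meq p q.
Proof.
move=> sc cp cq; have [P [hP ->]] := idem_classE cp.
have [Q [hQ ->]] := idem_classE cq => /(SK0_class_inj sc) h.
by apply/meq_mx1; apply: mxrep_eq hP hQ h.
Qed.

Lemma idem_classD p q : cidem p -> cidem q -> cidem (p + q) ->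
  p * q = 0 -> q * p = 0 ->
  idem_class (p + q) = cmD (idem_class p) (idem_class q).
Proof.
move=> cp cq cpq pq qp; have [P [hP ->]] := idem_classE cp.
have [Q [hQ ->]] := idem_classE cq; have [M [hM ->]] := idem_classE cpq.
rewrite -SK0_classD; apply: SK0_class_iso.
apply: mxrep_iso hM (mxrep_prod hP hQ) _.
exists (row_mx (mx1 p) (mx1 q)), (col_mx (mx1 p) (mx1 q)).
by rewrite mul_row_col mul_col_row !mx1M !cidem_mul // pq qp mx1D mx1_0.
Qed.

Lemma idem_class0 : idem_class 0 = cm0.
Proof.
rewrite -SK0_class0; apply: idem_class_rep.
  by exists 1; rewrite add0r mul0r mulr0.
rewrite mx1_0; pose I : {linear 'rV[S^c]_0 -> 'rV[S^c]_1} := \0.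
pose J : {linear 'rV[S^c]_1 -> 'rV[S^c]_0} := \0.
exists I, J; split=> [u|v]; first by rewrite /= [u]thinmx0.
by rewrite mulmx0.
Qed.

Lemma idem_class1 : idem_class 1 = SK0_unit S.
Proof.
apply: idem_class_rep; first exact: cidem1.
have [f [g [fK gK]]] := mod_iso_inv (mod_iso_regular S^c).
by exists f, g; split=> // v; apply: etrans (gK v) (esym (mulmx1 v)).
Qed.

Lemma idem_class_cone p : SK0_cone (idem_class p).
Proof.
rewrite /idem_class; case: pselect => [h|_]; first by exists (projT1 (cid h)).
by exists (fgsp_zero S).
Qed.

(** A decomposition of the class inside the cone is realized by a decomposition of the idempotent
    itself: an isomorphism of [P] with [P1 * P2] carries the two block projections back into the
    corner of [p]. *)
Lemma idem_class_split p (x y : SK0 S) : stably_cancellative S^c ->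
  cidem p -> SK0_cone x -> SK0_cone y -> idem_class p = cmD x y ->
  exists q r, [/\ p = q + r, q * r = 0 /\ r * q = 0, cidem q /\ cidem r,
                  idem_class q = x & idem_class r = y].
Proof.
move=> sc cp [P1 ->] [P2 ->]; have [P [hP ->]] := idem_classE cp.
rewrite -SK0_classD => /(SK0_class_inj sc) h.
have [m [e [ce eP]]] := fgsp_mxrep P1; have [n [f [cf fQ]]] := fgsp_mxrep P2.
have [x0 [y0 [xy0 yx0]]] := mxrep_eq hP (mxrep_prod eP fQ) h.
have ee := mxcpl_idem ce; have ff := mxcpl_idem cf.
have pp : mx1 p *m mx1 p = mx1 p by rewrite mx1M cidem_mul.
have [p' [p1 pp' p'p]] := cp.
set b := block_mx e 0 0 f in yx0.
have bb : b *m b = b.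
  by rewrite mulmx_block ee ff !mulmx0 !mul0mx !addr0 !add0r.
(* After cutting by [p], the blocks of [X] and [Y] are fixed by [p]; hence [q] and [r] below lie in
   the corner of [p]. *)
pose X := mx1 p *m x0; pose Y := y0 *m mx1 p.
have XY : X *m Y = mx1 p by rewrite mulmxA -(mulmxA _ x0) xy0 pp pp.
have YX : Y *m X = b.
  by rewrite -mulmxA (mulmxA (mx1 p)) pp -xy0 -mulmxA (mulmxA y0) yx0 bb.
have pX : mx1 p *m X = X by rewrite mulmxA pp.
have Yp : Y *m mx1 p = Y by rewrite -mulmxA pp.
move: XY YX pX Yp; rewrite -(hsubmxK X) -(vsubmxK Y).
move: (lsubmx X) (rsubmx X) (usubmx Y) (dsubmx Y) => x1 x2 y1 y2.
rewrite mul_row_col mul_col_row mul_mx_row mul_col_mx => XY.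
move=> /eq_block_mx[y11 y12 y21 y22] /eq_row_mx[px1 px2] /eq_col_mx[yp1 yp2].
(* [X Y = p] gives [p = q + r], and the vanishing off-diagonal blocks of [Y X] give orthogonality.
   The complement of [q] is then [r + p'], and that of [r] is [q + p']. *)
pose q : S := (x1 *m y1) 0 0; pose r : S := (x2 *m y2) 0 0.
have qE : mx1 q = x1 *m y1 by rewrite -mx1E.
have rE : mx1 r = x2 *m y2 by rewrite -mx1E.
have pqr : p = q + r by apply: mx1_inj; rewrite -mx1D qE rE.
have rq : r * q = 0.
  by apply: mx1_inj; rewrite -mx1M qE rE mulmxA -(mulmxA x1) y12 mulmx0 mul0mx mx1_0.
have qr : q * r = 0.
  by apply: mx1_inj; rewrite -mx1M qE rE mulmxA -(mulmxA x2) y21 mulmx0 mul0mx mx1_0.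
have qp : q * p = q by apply: mx1_inj; rewrite -mx1M qE mulmxA px1.
have pq : p * q = q by apply: mx1_inj; rewrite -mx1M qE -mulmxA yp1.
have rp : r * p = r by apply: mx1_inj; rewrite -mx1M rE mulmxA px2.
have pr : p * r = r by apply: mx1_inj; rewrite -mx1M rE -mulmxA yp2.
have qp' : q * p' = 0 by rewrite -qp -mulrA pp' mulr0.
have p'q : p' * q = 0 by rewrite -pq mulrA p'p mul0r.
have rp' : r * p' = 0 by rewrite -rp -mulrA pp' mulr0.
have p'r : p' * r = 0 by rewrite -pr mulrA p'p mul0r.
have cq : cidem q.
  by exists (r + p'); rewrite addrA -pqr p1 mulrDr mulrDl qr rq qp' p'q addr0.
have cr : cidem r.
  exists (q + p'); rewrite addrA (addrC r) -pqr p1 mulrDr mulrDl qr rq rp' p'r.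
  by rewrite addr0.
exists q, r; split=> //.
  have [Q [hQ ->]] := idem_classE cq; apply: SK0_class_iso.
  by apply: (mxrep_iso hQ eP); exists x1, y1; rewrite qE y11.
have [Q [hQ ->]] := idem_classE cr; apply: SK0_class_iso.
by apply: (mxrep_iso hQ fQ); exists x2, y2; rewrite rE y22.
Qed.

End ClassesOfIdempotents.

Lemma fmul_converse (S : pzSemiRingType) m n k (x : 'M[S^c]_(m, n))
    (y : 'M[S^c]_(n, k)) :
  (fun i j => (x *m y) j i) =
  fmul (R := S) (fun i j => y j i) (fun i j => x j i).
Proof. by apply: eq2_fun => i j; rewrite mxE. Qed.

Lemma filtration_stably_cancellative (F : comNzSemiRingType) (S : semiAlgType F) :
  semifield F -> torsion_free S -> mu_filtration S -> stably_cancellative S^c.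
Proof.
move=> hF tf [I [c [e [me ne le se]]]] m n p r q s cp cr cq cs pr rp qs sq.
move=> [x [y [xy yx]]] [z [w [zw wz]]].
(* Transposition passes from matrices over [S^c] to function matrices over [S] and reverses
   products, so the two factors of each equivalence change places. *)
pose t k l (A : 'M[S^c]_(k, l)) : 'I_l -> 'I_k -> S := fun i j => A j i.
have tM k l u (A : 'M[S^c]_(k, l)) (B : 'M[S^c]_(l, u)) :
    t _ _ (A *m B) = fmul (t _ _ B) (t _ _ A) by exact: fmul_converse.
have t0 k l : t k l 0 = fzero by apply: eq2_fun => i j; rewrite /t mxE.
have t1 k : t k k 1%:M = fone.
  by apply: eq2_fun => i j; rewrite /t mxE eq_sym.
have tD k l (A B : 'M[S^c]_(k, l)) : t _ _ (A + B) = fadd (t _ _ A) (t _ _ B).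
  by apply: eq2_fun => i j; rewrite /t mxE.
have tc k (A : 'M[S^c]_k) : mxcpl A -> fcpl (t _ _ A).
  by case=> B [h1 h2 h3]; exists (t _ _ B); rewrite -tD -!tM h1 h2 h3 t0 t1.
have [X [Y [XY YX]]] : feq (t _ _ p) (t _ _ q).
  apply: (filtered_cancel hF tf me ne le se
    (tc _ _ cp) (tc _ _ cr) (tc _ _ cq) (tc _ _ cs));
    rewrite -?tM -?tD ?pr ?rp ?qs ?sq ?t0 //.
    by exists (t _ _ y), (t _ _ x); rewrite -!tM xy yx.
  by exists (t _ _ w), (t _ _ z); rewrite -!tM zw wz.
pose T k l (A : 'I_l -> 'I_k -> S) : 'M[S^c]_(k, l) := \matrix_(i, j) A j i.
have tT k l (A : 'I_l -> 'I_k -> S) : t _ _ (T _ _ A) = A.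
  by apply: eq2_fun => i j; rewrite /t mxE.
have ti k l (A B : 'M[S^c]_(k, l)) : t _ _ A = t _ _ B -> A = B.
  by move=> h; apply/matrixP => i j; apply: (congr1 (fun f => f j i) h).
by exists (T _ _ Y), (T _ _ X); split; apply: ti; rewrite tM !tT.
Qed.

(** * Lifting matrix units *)

Section MatrixUnitIdempotents.

Variables (F : comNzSemiRingType) (S : semiAlgType F).
Variables (I : finType) (c : I -> nat) (e : I -> I -> S) (me : musys c e).

Lemma mu_sum_orth (P Q : pred I) : (forall i, P i -> Q i -> false) ->
  (\sum_(i | P i) e i i) * (\sum_(i | Q i) e i i) = 0.
Proof.
move=> PQ; rewrite mulr_suml big1 // => i Pi; rewrite mulr_sumr big1 // => j Qj.
apply: (mu_orth me); apply/eqP => eij.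
by move: (PQ i Pi); rewrite eij Qj => /(_ isT).
Qed.

Lemma mu_sum_cidem (P : pred I) : cidem (\sum_(i | P i) e i i).
Proof.
exists (\sum_(i | ~~ P i) e i i); rewrite -(mu_sum me) [RHS](bigID P) /=.
by split=> //; apply: mu_sum_orth => i; case: (P i).
Qed.

Lemma mu_cidem i : cidem (e i i).
Proof. by have := mu_sum_cidem (pred1 i); rewrite big_pred1_eq. Qed.

Lemma mu_seq_cidem (s : seq I) : uniq s -> cidem (\sum_(i <- s) e i i).
Proof. by move=> us; rewrite big_uniq //; apply: mu_sum_cidem. Qed.

Lemma mu_seq_orth i (s : seq I) : i \notin s ->
  e i i * (\sum_(j <- s) e j j) = 0 /\ (\sum_(j <- s) e j j) * e i i = 0.
Proof.
move=> nis; rewrite mulr_suml mulr_sumr.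
split; rewrite big_seq big1 // => j js; apply: (mu_orth me).
  by apply: contraNneq nis => ->.
by apply: contraNneq nis => <-.
Qed.

Lemma mu_meq i j : c i = c j -> meq (e i i) (e j j).
Proof. by move=> cij; exists (e i j), (e j i); rewrite !(mu_mul me). Qed.

Lemma mu_idem i : e i i * e i i = e i i.
Proof. by rewrite (mu_mul me). Qed.

Lemma mspan_cpl (tf : torsion_free S) (ne : forall i, e i i != 0) (X : I -> I -> F) p' :
  supp c c X -> lin e X + p' = 1 -> lin e X * p' = 0 -> p' * lin e X = 0 ->
  mspan c e p' -> ccpl c X.
Proof.
move=> cX h1 h2 h3 [X' cX' ep']; rewrite ep' in h1 h2 h3.
split=> //; exists X'.
have inj := lin_inj me tf ne; split; apply: inj => //.
- exact: supp_fadd.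
- exact: supp_fone.
- by rewrite linD (lin1 me).
- exact: supp_fmul cX cX'.
- by rewrite (linM me) ?lin0.
- exact: supp_fmul cX' cX.
- by rewrite (linM me) ?lin0.
Qed.

End MatrixUnitIdempotents.

(** The list [s] depends only on the coefficients [X] and is chosen before the algebra, so that one
    list serves for the matrix units of [S] and for their counterparts in [T]. *)
Lemma ccpl_mu_sum (F : comNzSemiRingType) (hF : semifield F) (I : finType)
    (c : I -> nat) (X : I -> I -> F) : ccpl c X ->
  exists2 s : seq I, uniq s &
    forall (S : semiAlgType F) (e : I -> I -> S), musys c e ->
      meq (lin e X) (\sum_(i <- s) e i i).
Proof.
move=> cX; have [L [f [fi [x [y [sx sy xy yx]]]]]] := ceq_split hF cX.
exists [seq f l | l <- enum L]; first by rewrite map_inj_uniq ?enum_uniq.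
(* [G] and [H] are the matrices of the inclusion [f] and its transpose: [G H] is the identity on
   [L], and [H G] is the sum of the diagonal units at the image of [f]. *)
move=> S e me; pose G l i : F := (f l == i)%:R; pose H i l : F := (f l == i)%:R.
have GH : fmul G H = fone.
  apply: eq2_fun => k l; rewrite /fmul /fone (bigD1 (f k)) //= /G /H eqxx mul1r.
  rewrite (inj_eq fi) eq_sym big1 ?addr0 // => i.
  by rewrite eq_sym => /negPf->; rewrite mul0r.
have sG : supp (c \o f) c G.
  by move=> l i; rewrite /G; case: (eqVneq (f l) i) => // <-; rewrite eqxx.
have sH : supp c (c \o f) H.
  by move=> i l; rewrite /H; case: (eqVneq (f l) i) => // <-; rewrite eqxx.
exists (lin e (fmul x G)), (lin e (fmul H y)); split.
  rewrite -(linM me); last exact: supp_fmul sx sG.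
  by rewrite -fmulA (fmulA G) GH fmul1x xy.
rewrite -(linM me); last exact: supp_fmul sH sy.
rewrite -fmulA (fmulA y) yx fmul1x /fmul lin_sum big_map big_enum /=.
apply: eq_bigr => l _; rewrite -lin_delta /lin; apply: eq_bigr => i _.
by apply: eq_bigr => j _; rewrite /G /H (eq_sym i) (eq_sym j).
Qed.

Section Transfer.

Variables (F : comNzSemiRingType) (S T : semiAlgType F).
Variables (I : finType) (c : I -> nat) (e : I -> I -> S) (me : musys c e).
Variables (J : finType) (d : J -> nat) (b : J -> J -> S) (mb : musys d b).
Variables (tf : torsion_free S) (nb : forall j, b j j != 0).
Variables (b' : J -> J -> T) (mb' : musys d b').
Variable X : I -> I -> J -> J -> F.
Hypothesis sX : forall i j, supp d d (X i j).
Hypothesis eX : forall i j, e i j = lin b (X i j).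

(** Since [lin b] is injective, the relations satisfied by [e] are identities between the
    coefficient matrices [X i j]; these can be evaluated in any system with the same colours. *)
Lemma musys_transfer : musys c (fun i j => lin b' (X i j)).
Proof.
have inj := lin_inj mb tf nb.
split.
- move=> i j nij; suff -> : X i j = fzero by rewrite lin0.
  by apply: inj => //; rewrite -eX lin0 (mu_off me).
- move=> i j k cij; rewrite -(linM mb') //; congr lin; apply: inj => //.
    exact: supp_fmul (sX i j) (sX j k).
  by rewrite (linM mb) // -!eX (mu_mul me).
- move=> i j k l njk; rewrite -(linM mb') //.
  suff -> : fmul (X i j) (X k l) = fzero by rewrite lin0.
  apply: inj => //; first exact: supp_fmul (sX i j) (sX k l).
  by rewrite (linM mb) // -!eX lin0 (mu_orth me).
- rewrite -lin_sum -(lin1 mb'); congr lin; apply: inj => //.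
  + by move=> k l nkl; rewrite big1 // => i _; rewrite sX.
  + exact: supp_fone.
  + rewrite lin_sum (lin1 mb) -(mu_sum me).
    by apply: eq_bigr => i _; rewrite eX.
Qed.

End Transfer.

(** * Construction and conjugacy of systems of matrix units *)

Section Building.

Variables (F : comNzSemiRingType) (T : semiAlgType F) (I : finType) (c : I -> nat).

(** The predicate given to [pick] depends on [i] only through [c i], so all indices of a block get
    the same representative. The default is never taken, [i] itself being a candidate. *)
Definition block_rep (i : I) : I := odflt i [pick j | c j == c i].

Lemma block_repE i : c (block_rep i) = c i.
Proof. by rewrite /block_rep; case: pickP => [j /eqP|]. Qed.

Lemma eq_block_rep i j : c i = c j -> block_rep i = block_rep j.
Proof.
move=> cij; rewrite /block_rep -cij; case: pickP => // /(_ i).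
by rewrite eqxx.
Qed.

(** Each [Q i] is linked to the idempotent of the representative of its block, and the unit from [i]
    to [j] goes through that representative. This star shape makes the products consistent. *)
Lemma musys_build (Q : I -> T) :
  \sum_i Q i = 1 -> (forall i j, i != j -> Q i * Q j = 0) ->
  (forall i, Q i * Q i = Q i) -> (forall i j, c i = c j -> meq (Q i) (Q j)) ->
  exists2 e, musys c e & forall i, e i i = Q i.
Proof.
move=> Q1 Qo QQ Qc.
have h i : exists u : T * T, [/\ u.1 * u.2 = Q i, u.2 * u.1 = Q (block_rep i),
    Q i * u.1 = u.1 /\ u.1 * Q (block_rep i) = u.1
  & Q (block_rep i) * u.2 = u.2 /\ u.2 * Q i = u.2].
  have [x [y ?]] := meq_cut (QQ _) (QQ _) (Qc _ _ (esym (block_repE i))).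
  by exists (x, y).
have [u hu] := choice h.
exists (fun i j => if c i == c j then (u i).1 * (u j).2 else 0); last first.
  by move=> i; rewrite eqxx; case: (hu i).
split=> [i j /negPf-> //|i j k cij|i j k l njk|]; last first.
- by rewrite -Q1; apply: eq_bigr => i _; rewrite eqxx; case: (hu i).
- case: eqP => [_|_]; last by rewrite mul0r.
  case: eqP => [_|_]; last by rewrite mulr0.
  have [_ _ _ [_ <-]] := hu j; have [_ _ [<- _] _] := hu k.
  by rewrite -!mulrA (mulrA (Q j)) Qo // mul0r !mulr0.
- rewrite cij eqxx; case: eqP => [_|_]; last by rewrite mulr0.
  have [_ e1 _ _] := hu j; have [_ _ [_ e2] _] := hu i.
  by rewrite -!mulrA (mulrA (u j).2) e1 mulrA -(eq_block_rep cij) e2.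
Qed.

(** One equivalence per block, at its representative, is spread over the block by the units of both
    systems. The sums [u] and [v] are mutually inverse because both diagonals add up to 1. *)
Lemma musys_conj (w e : I -> I -> T) : musys c w -> musys c e ->
  (forall i, meq (w i i) (e i i)) ->
  exists u v, [/\ u * v = 1, v * u = 1 & forall i j, e i j = v * w i j * u].
Proof.
move=> mw me h.
have h' i : exists u : T * T, [/\ u.1 * u.2 = w i i, u.2 * u.1 = e i i,
    w i i * u.1 = u.1 /\ u.1 * e i i = u.1
  & e i i * u.2 = u.2 /\ u.2 * w i i = u.2].
  by have [x [y ?]] := meq_cut (mu_idem mw i) (mu_idem me i) (h i); exists (x, y).
have [x hx] := choice h'.
pose r := block_rep; have cr i : c (r i) = c i by apply: block_repE.
pose u := \sum_i w i (r i) * (x (r i)).1 * e (r i) i.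
pose v := \sum_i e i (r i) * (x (r i)).2 * w (r i) i.
have wu i j : w i j * u = w i (r j) * (x (r j)).1 * e (r j) j.
  rewrite /u mulr_sumr (bigD1 j) //= big1 ?addr0 => [|k nkj].
    have [cij|nij] := eqVneq (c i) (c j); first by rewrite !mulrA (mu_mul mw).
    by rewrite (mu_off mw nij) !mul0r (mu_off mw) ?mul0r // cr.
  by rewrite !mulrA (mu_orth mw) ?mul0r // eq_sym.
have ue i j : u * e i j = w i (r i) * (x (r i)).1 * e (r i) j.
  rewrite /u mulr_suml (bigD1 i) //= big1 ?addr0 => [|k nki].
    by rewrite -!mulrA (mu_mul me) ?cr.
  by rewrite -!mulrA (mu_orth me) ?mulr0.
have uv : u * v = 1.
  rewrite -(mu_sum mw) /v mulr_sumr; apply: eq_bigr => i _.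
  rewrite !mulrA ue; have [xy _ [_ xe] _] := hx (r i).
  by rewrite -(mulrA _ _ (e _ _)) xe -(mulrA _ _ (x _).2) xy !(mu_mul mw) ?cr.
have vu : v * u = 1.
  rewrite -(mu_sum me) /v mulr_suml; apply: eq_bigr => i _.
  rewrite -!mulrA wu; have [_ yx [wx _] _] := hx (r i).
  by rewrite wx (mulrA (x _).2) yx !(mu_mul me) ?cr.
exists u, v; split=> // i j.
suff h2 : u * e i j = w i j * u by rewrite -mulrA -h2 mulrA vu mul1r.
rewrite ue wu; have [cij|nij] := eqVneq (c i) (c j).
  by rewrite /r (eq_block_rep cij).
by rewrite (mu_off me) ?cr // mulr0 (mu_off mw) ?cr // !mul0r.
Qed.

Lemma musys_conjugate (e : I -> I -> T) u v : musys c e -> u * v = 1 -> v * u = 1 ->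
  musys c (fun i j => v * e i j * u).
Proof.
move=> me uv vu.
have M i j k l : v * e i j * u * (v * e k l * u) = v * (e i j * e k l) * u.
  by rewrite -!mulrA (mulrA u) uv mul1r.
split=> [i j nij|i j k cij|i j k l njk|].
- by rewrite (mu_off me) // mulr0 mul0r.
- by rewrite M (mu_mul me).
- by rewrite M (mu_orth me) // mulr0 mul0r.
- by rewrite -mulr_suml -mulr_sumr (mu_sum me) mulr1.
Qed.

Lemma lin_conjugate (e : I -> I -> T) u v x :
  lin (fun i j => v * e i j * u) x = v * lin e x * u.
Proof.
rewrite /lin mulr_sumr mulr_suml; apply: eq_bigr => i _.
rewrite mulr_sumr mulr_suml; apply: eq_bigr => j _.
by rewrite -scalerAr -scalerAl.
Qed.

End Building.

Lemma abgroup_idem0 (A : abgroup) (x : A) : cmD x x = x -> x = cm0.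
Proof. by move=> xx; rewrite -[x]cm0D -(agND x) -cmDA xx. Qed.

(** * Extension of lifted matrix units along a morphism of [SK0] *)

Section Extension.

Variables (F : comNzSemiRingType) (hF : semifield F) (S T : semiAlgType F).
Hypotheses (tfS : torsion_free S) (scT : stably_cancellative T^c).
Variable f : SK0 S -> SK0 T.
Hypothesis fD : {morph f : x y / cmD x y}.
Hypothesis f_unit : f (SK0_unit S) = SK0_unit T.
Hypothesis f_cone : forall x, SK0_cone x -> SK0_cone (f x).

Lemma morph_cm0 : f cm0 = cm0.
Proof. by apply: abgroup_idem0; rewrite -fD cm0D. Qed.

Lemma class_mu_sum (I : finType) (c : I -> nat) (e : I -> I -> S)
    (e' : I -> I -> T) (s : seq I) : musys c e -> musys c e' ->
  (forall i, f (idem_class (e i i)) = idem_class (e' i i)) -> uniq s ->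
  f (idem_class (\sum_(i <- s) e i i)) = idem_class (\sum_(i <- s) e' i i).
Proof.
move=> me me' h; elim: s => [|i s IH] us.
  by rewrite !big_nil !idem_class0 morph_cm0.
have := us => /= /andP[nis us'].
have [o1 o2] := mu_seq_orth me nis; have [o1' o2'] := mu_seq_orth me' nis.
have := mu_seq_cidem me us; have := mu_seq_cidem me' us; rewrite !big_cons.
have := mu_cidem me' i; have := mu_cidem me i.
have := mu_seq_cidem me us'; have := mu_seq_cidem me' us' => *.
by rewrite !idem_classD // fD h IH.
Qed.

(** By induction on [s]: [idem_class_split] cuts off a piece of [q] for the first index, and the
    remainder is treated in the same way. *)
Lemma class_decompose (I : finType) (c : I -> nat) (e : I -> I -> S)
    (s : seq I) (q : T) : musys c e -> uniq s -> cidem q ->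
  f (idem_class (\sum_(i <- s) e i i)) = idem_class q ->
  exists Q : I -> T, [/\ \sum_(i <- s) Q i = q,
    {in s &, forall i j, i != j -> Q i * Q j = 0},
    {in s, forall i, cidem (Q i)}
    & {in s, forall i, f (idem_class (e i i)) = idem_class (Q i)}].
Proof.
move=> me; elim: s q => [|i s IH] q us cq.
  rewrite !big_nil idem_class0 morph_cm0 -idem_class0 => /esym h.
  exists (fun _ => 0); split=> //; rewrite big_nil; apply/esym/meq0.
    exact: cidem_mul.
  by apply: idem_class_inj h => //; exists 1; rewrite add0r mul0r mulr0.
have := us => /= /andP[nis us'].
have [o1 o2] := mu_seq_orth me nis; have := mu_seq_cidem me us; rewrite big_cons.
have := mu_cidem me i; have := mu_seq_cidem me us' => ? ? ?.
rewrite idem_classD // fD => /esym /(idem_class_split scT cq (f_cone (idem_class_cone _))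
  (f_cone (idem_class_cone _)))[q1 [q2 [qE [q12 q21] [c1 c2] h1 h2]]].
have [Q [Qs Qo Qc Qf]] := IH _ us' c2 (esym h2).
(* Each [Q j] lies under [q2], which makes it orthogonal to [q1]. *)
have Q2 j : j \in s -> Q j * q2 = Q j /\ q2 * Q j = Q j.
  move=> js; rewrite -Qs mulr_suml mulr_sumr.
  split; rewrite (bigD1_seq j) //= (cidem_mul (Qc _ js)) big_seq_cond big1 ?addr0 //;
    by move=> k /andP[ks nkj]; rewrite Qo // eq_sym.
exists (fun j => if j == i then q1 else Q j); split.
- rewrite big_cons eqxx qE -[in RHS]Qs; congr (_ + _); apply: eq_big_seq => j js.
  by case: eqP => // eji; rewrite -eji js in nis.
- move=> j k; rewrite !inE; case: (eqVneq j i) => [->|nji] /=.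
    move=> _; case: (eqVneq k i) => [->|nki] /= ks; first by [].
    by move=> _; rewrite -(Q2 k ks).2 mulrA q12 mul0r.
  move=> js; case: (eqVneq k i) => [->|nki] /= ks njk; last exact: Qo.
  by rewrite -(Q2 j js).1 -mulrA q21 mulr0.
- by move=> j; rewrite inE; case: (eqVneq j i) => //= _; apply: Qc.
- by move=> j; rewrite inE; case: (eqVneq j i) => [->//|_] /=; apply: Qf.
Qed.

(* Lift the idempotents of b to T, complete them to matrix units, and then
   conjugate these so that they become compatible with e'. *)
Lemma extend_musys (I J : finType) (c : I -> nat) (d : J -> nat)
    (e : I -> I -> S) (e' : I -> I -> T) (b : J -> J -> S) :
  musys c e -> musys c e' ->
  (forall i, f (idem_class (e i i)) = idem_class (e' i i)) ->
  musys d b -> (forall j, b j j != 0) -> (forall i j, mspan d b (e i j)) ->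
  exists b' : J -> J -> T, [/\ musys d b',
    forall j, f (idem_class (b j j)) = idem_class (b' j j)
    & forall X i j, supp d d X -> e i j = lin b X -> e' i j = lin b' X].
Proof.
move=> me me' h mb nb eb.
(* The [b j j] add up to 1 and [f] preserves the class of 1. *)
have [Q [Q1 Qo Qc Qf]] : exists Q : J -> T, [/\ \sum_(i <- enum J) Q i = 1,
    {in enum J &, forall i j, i != j -> Q i * Q j = 0},
    {in enum J, forall i, cidem (Q i)}
    & {in enum J, forall i, f (idem_class (b i i)) = idem_class (Q i)}].
  apply: (class_decompose mb (enum_uniq _) (cidem1 _)).
  by rewrite big_enum /= (mu_sum mb) !idem_class1 f_unit.
have inJ j : j \in enum J by rewrite mem_enum.
have [b2 mb2 b2E] : exists2 b2, musys d b2 & forall j, b2 j j = Q j.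
  apply: musys_build => [|i j||i j dij].
  - by rewrite -Q1 big_enum.
  - by apply: Qo.
  - by move=> i; apply: cidem_mul; apply: Qc.
  (* Idempotents in one block of [b] are equivalent, hence have the same class; cancellation in [T]
     makes their lifts equivalent. *)
  - apply: idem_class_inj => //; try exact: Qc.
    rewrite -!Qf //; congr f; apply: idem_class_meq; try exact: (mu_cidem mb).
    exact: (mu_meq mb).
have fb2 j : f (idem_class (b j j)) = idem_class (b2 j j) by rewrite b2E Qf.
have hX (u : I * I) : exists X, supp d d X /\ e u.1 u.2 = lin b X.
  by have [X sX eX] := eb u.1 u.2; exists X.
have [X hX'] := choice hX.
have sX i j : supp d d (X (i, j)) by case: (hX' (i, j)).
have eX i j : e i j = lin b (X (i, j)) by case: (hX' (i, j)).
(* The copy of [e] in [T]: the same coefficients, with [b2] in place of [b]. *)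
have mw := musys_transfer me mb tfS nb mb2 (X := fun i j => X (i, j)) sX eX.
have [u [v [uv vu uve]]] : exists u v, [/\ u * v = 1, v * u = 1 &
    forall i j, e' i j = v * lin b2 (X (i, j)) * u].
  apply: (musys_conj mw me') => i.
  apply: idem_class_inj; [by []|exact: (mu_cidem mw)|exact: (mu_cidem me')|].
  (* Both [e i i] and its complement lie in the span of [b], so [X (i, i)] is complemented over [F].
     Then [e i i] and its copy are equivalent to sums of diagonal units over the same list, and [f]
     matches the classes of these sums. *)
  rewrite -h; have cX : ccpl d (X (i, i)).
    have o (A B : pred I) : (forall i, A i -> B i -> false) ->
        (\sum_(j | A j) e j j) * (\sum_(j | B j) e j j) = 0.
      exact: (mu_sum_orth me).
    have ee : e i i = \sum_(j | j == i) e j j by rewrite big_pred1_eq.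
    apply: (mspan_cpl mb tfS nb (p' := \sum_(j | j != i) e j j)) => //.
    - by rewrite -eX -(mu_sum me) [RHS](bigD1 i).
    - by rewrite -eX ee; apply: o => j -> .
    - by rewrite -eX ee; apply: o => j /negP.
    - rewrite big_mkcond; apply: mspan_sum => j.
      by case: ifP => // _; apply: mspan0.
  have [s us hs] := ccpl_mu_sum hF cX.
  rewrite -(idem_class_meq _ _ (meq_sym (hs _ _ mb2))); last 2 first.
  - exact: (mu_seq_cidem mb2).
  - exact: (mu_cidem mw).
  rewrite -(class_mu_sum mb mb2 fb2 us); congr f; apply: idem_class_meq.
  - exact: (mu_seq_cidem mb).
  - exact: (mu_cidem me).
  - by rewrite eX; apply: meq_sym; apply: hs.
(* Conjugation leaves the classes unchanged and carries the copy of [e] onto [e']. *)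
exists (fun i j => v * b2 i j * u); split.
- exact: musys_conjugate.
- move=> j; rewrite fb2; apply: idem_class_meq; first exact: (mu_cidem mb2).
    exact: (mu_cidem (musys_conjugate mb2 uv vu)).
  exists (b2 j j * u), (v * b2 j j); rewrite !mulrA -(mulrA _ u) uv mulr1.
  by rewrite -(mulrA v) !(mu_idem mb2).
- move=> Y i j sY eY; rewrite lin_conjugate uve; congr (_ * _ * _).
  by congr lin; apply: (lin_inj mb tfS nb) => //; rewrite -eX.
Qed.

End Extension.

(** * Back and forth *)

(** An isomorphism presented by its graph, the form in which a union of partial isomorphisms
    arises. *)
Lemma alg_iso_of_rel (F : comNzSemiRingType) (S T : semiAlgType F)
    (r : S -> T -> Prop) :
  (forall s, exists t, r s t) -> (forall t, exists s, r s t) ->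
  (forall s t t', r s t -> r s t' -> t = t') ->
  (forall s s' t, r s t -> r s' t -> s = s') ->
  r 1 1 -> (forall s t s' t', r s t -> r s' t' -> r (s * s') (t * t')) ->
  (forall s t s' t', r s t -> r s' t' -> r (s + s') (t + t')) ->
  (forall a s t, r s t -> r (a *: s) (a *: t)) -> alg_iso S T.
Proof.
move=> /choice[f fr] /choice[g gr] rf ri r1 rM rD rZ.
have fL : semilinear f.
  split=> [a s|s s']; first exact: rf (fr _) (rZ _ _ _ (fr _)).
  exact: rf (fr _) (rD _ _ _ _ (fr _) (fr _)).
have fM : monoid_morphism f.
  by split=> [|s s']; [apply: rf (fr _) r1|apply: rf (fr _) (rM _ _ _ _ (fr _) (fr _))].
pose b := GRing.isSemilinear.Build F S T *:%R f fL.
pose b' := GRing.isMonoidMorphism.Build S T f fM.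
pose h : {lrmorphism S -> T} := HB.pack f b b'.
exists h; exists g => [s|t] /=; first exact: ri (gr _) (fr _).
exact: rf (fr _) (gr _).
Qed.

Section Graph.

Variables (F : comNzSemiRingType) (S T : semiAlgType F).
Variables (I : finType) (c : I -> nat) (e : I -> I -> S) (e' : I -> I -> T).

Definition mgraph (s : S) (t : T) : Prop :=
  exists x, [/\ supp c c x, s = lin e x & t = lin e' x].

Hypotheses (me : musys c e) (me' : musys c e').

Lemma mgraph1 : mgraph 1 1.
Proof.
by exists fone; split; [exact: supp_fone|rewrite (lin1 me)|rewrite (lin1 me')].
Qed.

Lemma mgraph0 : mgraph 0 0.
Proof. by exists fzero; rewrite !lin0. Qed.

Lemma mgraphD s t s' t' : mgraph s t -> mgraph s' t' -> mgraph (s + s') (t + t').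
Proof.
move=> [x [sx -> ->]] [y [sy -> ->]]; exists (fadd x y).
by rewrite !linD; split=> //; apply: supp_fadd.
Qed.

Lemma mgraphM s t s' t' : mgraph s t -> mgraph s' t' -> mgraph (s * s') (t * t').
Proof.
move=> [x [sx -> ->]] [y [sy -> ->]]; exists (fmul x y).
by rewrite (linM me) // (linM me') //; split=> //; apply: supp_fmul sx sy.
Qed.

Lemma mgraphZ a s t : mgraph s t -> mgraph (a *: s) (a *: t).
Proof.
move=> [x [sx -> ->]]; exists (fun i j => a * x i j); rewrite !linZ; split=> //.
by move=> i j nij; rewrite sx ?mulr0.
Qed.

Lemma mgraph_sum (A : finType) (s : A -> S) (t : A -> T) :
  (forall a, mgraph (s a) (t a)) -> mgraph (\sum_a s a) (\sum_a t a).
Proof.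
by move=> h; elim/big_ind2: _ => // [|s1 t1 s2 t2]; [apply: mgraph0|apply: mgraphD].
Qed.

Lemma mgraph_fun (tf : torsion_free S) (ne : forall i, e i i != 0) s t t' :
  mgraph s t -> mgraph s t' -> t = t'.
Proof.
by move=> [x [sx -> ->]] [y [sy /(lin_inj me tf ne sx sy)-> ->]].
Qed.

Lemma mgraph_inj (tf : torsion_free T) (ne : forall i, e' i i != 0) s s' t :
  mgraph s t -> mgraph s' t -> s = s'.
Proof.
by move=> [x [sx -> ->]] [y [sy -> /(lin_inj me' tf ne sx sy)->]].
Qed.

End Graph.

(** By linearity the inclusion of graphs can be tested on matrix units. *)
Lemma mgraph_ext (F : comNzSemiRingType) (S T : semiAlgType F)
    (I J : finType) (c : I -> nat) (e : I -> I -> S) (e' : I -> I -> T)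
    (d : J -> nat) (b : J -> J -> S) (b' : J -> J -> T) :
  (forall i j, mgraph d b b' (e i j) (e' i j)) ->
  forall s t, mgraph c e e' s t -> mgraph d b b' s t.
Proof.
move=> h s t [x [sx -> ->]]; apply: mgraph_sum => i; apply: mgraph_sum => j.
exact: mgraphZ.
Qed.

Section BackAndForth.

Variables (F : comNzSemiRingType) (hF : semifield F) (S T : semiAlgType F).
Hypotheses (tfS : torsion_free S) (tfT : torsion_free T).
Hypotheses (scS : stably_cancellative S^c) (scT : stably_cancellative T^c).

(** A finite partial isomorphism, matching the units [mp_l] with [mp_r]. The condition [mp_class] is
    what allows it to be extended; nonzero diagonals make the matching well defined in both
    directions. *)
Record mu_pair (f : SK0 S -> SK0 T) := MuPair {
  mp_ix : finType;
  mp_col : mp_ix -> nat;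
  mp_l : mp_ix -> mp_ix -> S;
  mp_r : mp_ix -> mp_ix -> T;
  mp_lP : musys mp_col mp_l;
  mp_rP : musys mp_col mp_r;
  mp_l0 : forall i, mp_l i i != 0;
  mp_r0 : forall i, mp_r i i != 0;
  mp_class : forall i, f (idem_class (mp_l i i)) = idem_class (mp_r i i) }.

Definition mp_graph f (p : mu_pair f) := mgraph (@mp_col f p) (@mp_l f p) (@mp_r f p).

Definition mp_le f (p q : mu_pair f) : Prop :=
  forall s t, mp_graph p s t -> mp_graph q s t.

Variables (f : SK0 S -> SK0 T) (g : SK0 T -> SK0 S).
Hypotheses (fK : cancel f g) (gK : cancel g f).
Hypothesis fD : {morph f : x y / cmD x y}.
Hypothesis f_unit : f (SK0_unit S) = SK0_unit T.
Hypothesis f_cone : forall x, SK0_cone x -> SK0_cone (f x).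
Hypothesis g_cone : forall x, SK0_cone x -> SK0_cone (g x).

Lemma inv_cmD : {morph g : x y / cmD x y}.
Proof. by move=> x y; rewrite -[in LHS](gK x) -[in LHS](gK y) -fD fK. Qed.

Lemma idem_class_eq0 (U : semiAlgType F) (p : U) : stably_cancellative U^c ->
  cidem p -> idem_class p = cm0 -> p = 0.
Proof.
move=> sc cp; rewrite -idem_class0 => h; apply: meq0; first exact: cidem_mul.
by apply: idem_class_inj h => //; exists 1; rewrite add0r mul0r mulr0.
Qed.

(** By cancellation a complemented idempotent of class 0 vanishes, and [f] sends 0, and only 0, to
    0. *)
Lemma class_neq0 (p : S) (q : T) : cidem p -> cidem q ->
  f (idem_class p) = idem_class q -> (p != 0) = (q != 0).
Proof.
have f0 := morph_cm0 fD.
move=> cp cq h; congr (~~ _); apply/eqP/eqP => [p0|q0].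
  apply: idem_class_eq0 scT cq _.
  by rewrite -h p0 idem_class0 f0.
apply: idem_class_eq0 scS cp _.
by rewrite -[LHS]fK h q0 idem_class0 -f0 fK.
Qed.

Variables (I : nat -> finType) (c : forall m, I m -> nat).
Arguments c {m}.

(** The starting pair consists of the single unit 1 on each side; its classes match because [f] is
    unital. *)
Lemma mp_init : mu_pair f.
Proof.
have m1 (U : semiAlgType F) : @musys F U unit (fun _ => 0%N) (fun _ _ => 1).
  split=> // [i j k _|]; rewrite ?mulr1 //.
  by rewrite (bigD1 tt) //= big1 ?addr0 // => -[].
apply: (MuPair (m1 S) (m1 T)) => *; rewrite ?oner_neq0 //.
by rewrite !idem_class1 f_unit.
Qed.

(** A stage [k] beyond [m] contains the left system of [p]; all its units are lifted to [T]
    compatibly with the right system. *)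
Lemma mp_forth (e : forall m, I m -> I m -> S) (p : mu_pair f) m :
  (forall m, musys (@c m) (e m)) -> (forall m i, e m i i != 0) ->
  (forall m z, mspan (@c m) (e m) z -> mspan (@c m.+1) (e m.+1) z) ->
  (forall z, exists m, mspan (@c m) (e m) z) ->
  exists2 q : mu_pair f, mp_le p q &
    forall s, mspan (@c m) (e m) s -> exists t, mp_graph q s t.
Proof.
move=> me ne le se.
have ev : eventually (fun k => (m <= k)%N /\
    (forall i j, mspan (@c k) (e k) (@mp_l f p i j))).
  apply: eventuallyI; first by exists m.
  apply: eventually_all => i; apply: eventually_all => j.
  exact: eventually_mspan.
have [k [mk hk]] := eventually_ex ev.
have [b' [mb' fb' hb']] := extend_musys hF tfS scT fD f_unit f_cone
  (@mp_lP f p) (@mp_rP f p) (@mp_class f p) (me k) (ne k) hk.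
have nb' j : b' j j != 0.
  by rewrite -(class_neq0 (mu_cidem (me k) j) (mu_cidem mb' j) (fb' j)).
exists (MuPair (me k) mb' (ne k) nb' fb').
  apply: mgraph_ext => i j; have [X sX eX] := hk i j; exists X; split=> //.
  exact: hb'.
have lek : forall s, mspan (@c m) (e m) s -> mspan (@c k) (e k) s.
  by rewrite -(subnK mk); elim: (k - m)%N => // n IH s /IH/le.
by move=> s /lek[x sx ->]; exists (lin b' x), x.
Qed.

(** The inverse [g] has the properties required of [f], so the extension lemma applies with [S] and
    [T] exchanged, lifting a stage of [T] to [S]. *)
Lemma mp_back (e : forall m, I m -> I m -> T) (p : mu_pair f) m :
  (forall m, musys (@c m) (e m)) -> (forall m i, e m i i != 0) ->
  (forall m z, mspan (@c m) (e m) z -> mspan (@c m.+1) (e m.+1) z) ->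
  (forall z, exists m, mspan (@c m) (e m) z) ->
  exists2 q : mu_pair f, mp_le p q &
    forall t, mspan (@c m) (e m) t -> exists s, mp_graph q s t.
Proof.
move=> me ne le se.
have ev : eventually (fun k => (m <= k)%N /\
    (forall i j, mspan (@c k) (e k) (@mp_r f p i j))).
  apply: eventuallyI; first by exists m.
  apply: eventually_all => i; apply: eventually_all => j.
  exact: eventually_mspan.
have [k [mk hk]] := eventually_ex ev.
have g_unit : g (SK0_unit T) = SK0_unit S by rewrite -f_unit fK.
have g_class i : g (idem_class (@mp_r f p i i)) = idem_class (@mp_l f p i i).
  by rewrite -mp_class fK.
have [b' [mb' gb' hb']] := extend_musys hF tfT scS inv_cmD g_unit g_cone
  (@mp_rP f p) (@mp_lP f p) g_class (me k) (ne k) hk.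
have fb' j : f (idem_class (b' j j)) = idem_class (e k j j) by rewrite -gb' gK.
have nb' j : b' j j != 0.
  by rewrite (class_neq0 (mu_cidem mb' j) (mu_cidem (me k) j) (fb' j)).
exists (MuPair mb' (me k) nb' (ne k) fb').
  apply: mgraph_ext => i j; have [X sX eX] := hk i j; exists X; split=> //.
  exact: hb'.
have lek : forall s, mspan (@c m) (e m) s -> mspan (@c k) (e k) s.
  by rewrite -(subnK mk); elim: (k - m)%N => // n IH s /IH/le.
by move=> s /lek[x sx ->]; exists (lin b' x), x.
Qed.

End BackAndForth.

Lemma alg_iso_of_SK0_iso (F : comNzSemiRingType) (S T : semiAlgType F) :
  semifield F -> torsion_free S -> torsion_free T ->
  mu_filtration S -> mu_filtration T -> SK0_iso S T -> alg_iso S T.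
Proof.
move=> hF tfS tfT mS mT [f [fD [g fK gK] f_unit f_coneE]].
have scS := filtration_stably_cancellative hF tfS mS.
have scT := filtration_stably_cancellative hF tfT mT.
have f_cone x : SK0_cone x -> SK0_cone (f x) by move=> h; apply/f_coneE; exists x.
have g_cone x : SK0_cone x -> SK0_cone (g x).
  by move=> /f_coneE[y hy <-]; rewrite fK.
have [I [c [e [me ne le se]]]] := mS; have [J [d [b [mb nb lb sb]]]] := mT.
have p0 := mp_init f_unit.
(* One round absorbs stage [m] of both filtrations, so that in the end every element of [S] and of
   [T] has a partner. *)
have next (m : nat) (p : mu_pair f) : exists q : mu_pair f, [/\ mp_le p q,
    forall s, mspan (@c m) (@e m) s -> exists t, mp_graph q s t &
    forall t, mspan (@d m) (@b m) t -> exists s, mp_graph q s t].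
  have [q pq hq] := mp_forth hF tfS scS scT fK fD f_unit f_cone p m me ne le se.
  have [r qr hr] := mp_back hF tfT scS scT fK gK fD f_unit g_cone q m mb nb lb sb.
  exists r; split=> [s t /pq/qr //|s /hq[t /qr h]|//]; by exists t.
pose st := fix st n := if n is m.+1 then projT1 (cid (next m (st m))) else p0.
have stP m := projT2 (cid (next m (st m))).
have st_le m n : (m <= n)%N -> mp_le (st m) (st n).
  move=> mn; rewrite -(subnK mn); elim: (n - m)%N => [//|k IH] s t /IH h.
  by have [+ _ _] := stP (k + m)%N; apply.
pose r s t := exists n, mp_graph (st n) s t.
have rr s t s' t' : r s t -> r s' t' ->
    exists n, mp_graph (st n) s t /\ mp_graph (st n) s' t'.
  move=> [m hm] [n hn]; exists (maxn m n).
  by split; [apply: st_le hm; apply: leq_maxl|apply: st_le hn; apply: leq_maxr].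
apply: (@alg_iso_of_rel _ _ _ r).
- move=> s; have [m hs] := se s; have [_ + _] := stP m.
  by move=> /(_ _ hs)[t ht]; exists t, m.+1.
- move=> t; have [m ht] := sb t; have [_ _] := stP m.
  by move=> /(_ _ ht)[s hs]; exists s, m.+1.
- move=> s t t' h h'; have [n [hn hn']] := rr _ _ _ _ h h'.
  exact: (mgraph_fun (mp_lP (st n)) tfS (@mp_l0 _ _ _ _ (st n)) hn hn').
- move=> s s' t h h'; have [n [hn hn']] := rr _ _ _ _ h h'.
  exact: (mgraph_inj (mp_rP (st n)) tfT (@mp_r0 _ _ _ _ (st n)) hn hn').
- by exists 0%N; apply: mgraph1; [apply: mp_lP|apply: mp_rP].
- move=> s t s' t' h h'; have [n [hn hn']] := rr _ _ _ _ h h'.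
  by exists n; apply: mgraphM => //; [apply: mp_lP|apply: mp_rP].
- move=> s t s' t' h h'; have [n [hn hn']] := rr _ _ _ _ h h'.
  by exists n; apply: mgraphD.
- by move=> a s t [n hn]; exists n; apply: mgraphZ.
Qed.

(** * Direct limits *)

(* The product of the A i modulo eventual equality: a test object that detects
   when two elements of A i have the same image in the limit. *)
Section Germs.

Variables (F : comNzSemiRingType) (A : nat -> semiAlgType F).
Implicit Types s t : forall i, A i.

Definition germ_eq s t : Prop := exists n, forall m, (n <= m)%N -> s m = t m.

Lemma germ_refl s : germ_eq s s. Proof. by exists 0%N. Qed.

Lemma germ_sym s t : germ_eq s t -> germ_eq t s.
Proof. by case=> n h; exists n => m /h. Qed.

Lemma germ_trans s t u : germ_eq s t -> germ_eq t u -> germ_eq s u.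
Proof.
case=> n h [m k]; exists (maxn n m) => l; rewrite geq_max => /andP[/h-> /k].
by [].
Qed.

Definition germ_rel s t : bool := `[< germ_eq s t >].

Lemma germ_rel_refl : reflexive germ_rel.
Proof. by move=> s; apply/asboolP; apply: germ_refl. Qed.

Lemma germ_rel_sym : symmetric germ_rel.
Proof. by move=> s t; apply: asbool_equiv_eq; split; apply: germ_sym. Qed.

Lemma germ_rel_trans : transitive germ_rel.
Proof.
by move=> t s u /asboolP st /asboolP tu; apply/asboolP; apply: germ_trans tu.
Qed.

Canonical germ_equiv :=
  EquivRel germ_rel germ_rel_refl germ_rel_sym germ_rel_trans.

Definition germ : Type := {eq_quot germ_equiv}%qT.
HB.instance Definition _ := Choice.on germ.
Definition gclass s : germ := (\pi_({eq_quot germ_equiv}) s)%qT.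
Definition grep (x : germ) : forall i, A i := repr x.

Lemma gclassP s t : gclass s = gclass t <-> germ_eq s t.
Proof. by split=> [/eqmodP/asboolP|h] //; apply/eqmodP/asboolP. Qed.

Lemma gclassE (x : germ) : exists s, x = gclass s.
Proof. by exists (grep x); rewrite /gclass /grep reprK. Qed.

Lemma grepr s : germ_eq (grep (gclass s)) s.
Proof. by apply/gclassP; rewrite /gclass /grep reprK. Qed.

Definition gadd (x y : germ) : germ := gclass (fun i => grep x i + grep y i).
Definition gmul (x y : germ) : germ := gclass (fun i => grep x i * grep y i).
Definition gscale (a : F) (x : germ) : germ := gclass (fun i => a *: grep x i).
Definition gzero : germ := gclass (fun i => 0).
Definition gone : germ := gclass (fun i => 1).

Lemma germ_eq2 (op : forall i, A i -> A i -> A i) s s' t t' :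
  germ_eq s s' -> germ_eq t t' ->
  germ_eq (fun i => op i (s i) (t i)) (fun i => op i (s' i) (t' i)).
Proof.
case=> n h [m k]; exists (maxn n m) => l; rewrite geq_max => /andP[/h-> /k->].
by [].
Qed.

Lemma gaddE s t : gadd (gclass s) (gclass t) = gclass (fun i => s i + t i).
Proof. by apply/gclassP; apply: (germ_eq2 (fun i => +%R)); apply: grepr. Qed.

Lemma gmulE s t : gmul (gclass s) (gclass t) = gclass (fun i => s i * t i).
Proof. by apply/gclassP; apply: (germ_eq2 (fun i => *%R)); apply: grepr. Qed.

Lemma gscaleE a s : gscale a (gclass s) = gclass (fun i => a *: s i).
Proof.
apply/gclassP; apply: (germ_eq2 (fun i x _ => a *: x) (grepr s)).
exact: (germ_refl s).
Qed.

Definition gE := (gaddE, gmulE, gscaleE).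

Ltac germ_axiom := repeat (let x := fresh "x" in move=> x;
    try (have [? ->] := gclassE x));
  rewrite ?/gzero ?/gone ?gE; congr gclass; apply: functional_extensionality_dep => i.

Lemma gaddA : associative gadd. Proof. by germ_axiom; rewrite addrA. Qed.
Lemma gaddC : commutative gadd. Proof. by germ_axiom; rewrite addrC. Qed.
Lemma gadd0 : left_id gzero gadd. Proof. by germ_axiom; rewrite add0r. Qed.

HB.instance Definition _ := GRing.isNmodule.Build germ gaddA gaddC gadd0.

Lemma gmulA : associative gmul. Proof. by germ_axiom; rewrite mulrA. Qed.
Lemma gmul1 : left_id gone gmul. Proof. by germ_axiom; rewrite mul1r. Qed.
Lemma gmulr1 : right_id gone gmul. Proof. by germ_axiom; rewrite mulr1. Qed.
Lemma gmulDl : left_distributive gmul gadd. Proof. by germ_axiom; rewrite mulrDl. Qed.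
Lemma gmulDr : right_distributive gmul gadd. Proof. by germ_axiom; rewrite mulrDr. Qed.
Lemma gmul0 : left_zero gzero gmul. Proof. by germ_axiom; rewrite mul0r. Qed.
Lemma gmulr0 : right_zero gzero gmul. Proof. by germ_axiom; rewrite mulr0. Qed.
Lemma gone_neq0 : gone != 0.
Proof.
by apply/eqP => /gclassP[n /(_ n (leqnn n))/eqP]; rewrite oner_eq0.
Qed.

HB.instance Definition _ := GRing.Nmodule_isNzSemiRing.Build germ
  gmulA gmul1 gmulr1 gmulDl gmulDr gmul0 gmulr0 gone_neq0.

Lemma gscaleA a b x : gscale a (gscale b x) = gscale (a * b) x.
Proof. by have [s ->] := gclassE x; germ_axiom; rewrite scalerA. Qed.
Lemma gscale0 x : gscale 0 x = 0.
Proof. by have [s ->] := gclassE x; germ_axiom; rewrite scale0r. Qed.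
Lemma gscale1 : left_id 1 gscale.
Proof. by move=> x; have [s ->] := gclassE x; germ_axiom; rewrite scale1r. Qed.
Lemma gscaleDr : right_distributive gscale gadd.
Proof. by germ_axiom; rewrite scalerDr. Qed.
Lemma gscaleDl x : {morph gscale^~ x : a b / a + b >-> gadd a b}.
Proof.
by move=> a b; have [s ->] := gclassE x; germ_axiom; rewrite scalerDl.
Qed.

HB.instance Definition _ := GRing.Nmodule_isLSemiModule.Build F germ
  gscaleA gscale0 gscale1 gscaleDr gscaleDl.

Lemma gscaleAl a x y : gscale a (gmul x y) = gmul (gscale a x) y.
Proof.
have [s ->] := gclassE x; have [t ->] := gclassE y.
by germ_axiom; rewrite scalerAl.
Qed.
HB.instance Definition _ := GRing.LSemiModule_isLSemiAlgebra.Build F germ gscaleAl.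

Lemma gscaleAr a x y : gscale a (gmul x y) = gmul x (gscale a y).
Proof.
have [s ->] := gclassE x; have [t ->] := gclassE y.
by germ_axiom; rewrite scalerAr.
Qed.
HB.instance Definition _ := GRing.LSemiAlgebra_isSemiAlgebra.Build F germ gscaleAr.

Variable f : forall i, {lrmorphism A i -> A i.+1}.

(** With [k + i] rather than [i + k], the target at [k.+1] reduces to [A (k + i).+1] and the
    composite needs no cast. *)
Fixpoint trans_map i k : {lrmorphism A i -> A (k + i)%N} :=
  match k with
  | 0 => [the {lrmorphism A i -> A i} of idfun]
  | k.+1 => [the {lrmorphism A i -> A (k + i).+1} of f (k + i) \o trans_map i k]
  end.

Definition thread i (x : A i) s : Prop :=
  s i = x /\ forall m, (i <= m)%N -> s m.+1 = f m (s m).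

Lemma thread_trans i x s k : @thread i x s -> s (k + i)%N = trans_map i k x.
Proof.
case=> si hs; elim: k => [//|k IH] /=.
by rewrite -IH -hs // leq_addl.
Qed.

Lemma thread_ex i (x : A i) : exists s, thread x s.
Proof.
(* The value at [m] must have type [A m] rather than [A (m - i + i)], so it is specified through
   casts along all proofs of [k + i = m]. Below [i] there are none and 0 serves. *)
have h m : exists y : A m, forall k (e : (k + i = m)%N),
    ecast n (A n) e (trans_map i k x) = y.
  have [im|mi] := leqP i m; last first.
    exists 0 => k e; exfalso; move: mi; rewrite -e ltnNge.
    by rewrite leq_addl.
  rewrite -(subnK im); exists (trans_map i (m - i) x) => k e.
  by have kE := addIn e; move: e; rewrite kE => e; rewrite eq_axiomK.
pose s m := projT1 (cid (h m)).
have sE k : s (k + i)%N = trans_map i k x.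
  by have := projT2 (cid (h (k + i)%N)) k erefl; rewrite -/(s _) => <-.
exists s; split; first exact: (sE 0%N).
by move=> m /subnK <-; rewrite (sE (m - i).+1) sE.
Qed.

Lemma thread_germ i (x : A i) s t : thread x s -> thread x t -> germ_eq s t.
Proof.
move=> hs ht; exists i => m /subnK<-.
by rewrite (thread_trans _ hs) (thread_trans _ ht).
Qed.

Definition to_germ i (x : A i) : germ := gclass (projT1 (cid (thread_ex x))).

Lemma to_germE i (x : A i) s : thread x s -> to_germ x = gclass s.
Proof. by move=> hs; apply/gclassP; apply: thread_germ hs; case: cid. Qed.

Lemma to_germ_semilinear i : semilinear (@to_germ i).
Proof.
split=> [a x|x y].
  have [s hs] := thread_ex x; rewrite (to_germE hs) -[RHS]/(gscale _ _) gE.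
  apply: to_germE; case: hs => si hs; split=> [|m /hs]; first by rewrite si.
  by move=> ->; rewrite linearZ.
have [s hs] := thread_ex x; have [t ht] := thread_ex y.
rewrite (to_germE hs) (to_germE ht) -[RHS]/(gadd _ _) gE.
apply: to_germE; case: hs ht => si hs [ti ht]; split=> [|m im].
  by rewrite si ti.
by rewrite hs // ht // linearD.
Qed.

Lemma to_germ_monoid_morphism i : monoid_morphism (@to_germ i).
Proof.
split=> [|x y].
  by apply: to_germE; split=> // m _; rewrite rmorph1.
have [s hs] := thread_ex x; have [t ht] := thread_ex y.
rewrite (to_germE hs) (to_germE ht) -[RHS]/(gmul _ _) gE.
apply: to_germE; case: hs ht => si hs [ti ht]; split=> [|m im].
  by rewrite si ti.
by rewrite hs // ht // rmorphM.
Qed.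

HB.instance Definition _ i := GRing.isSemilinear.Build F (A i) germ *:%R
  (@to_germ i) (to_germ_semilinear i).
HB.instance Definition _ i := GRing.isMonoidMorphism.Build (A i) germ
  (@to_germ i) (to_germ_monoid_morphism i).

Definition to_germ_lr i : {lrmorphism A i -> germ} := @to_germ i.

Lemma to_germ_cocone : cocone f to_germ_lr.
Proof.
move=> i x; have [s [si hs]] := thread_ex x.
rewrite -[RHS]/(to_germ x) (to_germE (conj si hs)); apply: to_germE.
by split=> [|m /ltnW/hs//]; rewrite hs // si.
Qed.

Lemma to_germ_eq i (x y : A i) : to_germ x = to_germ y ->
  exists k, trans_map i k x = trans_map i k y.
Proof.
have [s hs] := thread_ex x; have [t ht] := thread_ex y.
rewrite (to_germE hs) (to_germE ht) => /gclassP[n h]; exists n.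
by rewrite -(thread_trans _ hs) -(thread_trans _ ht) h // leq_addr.
Qed.

End Germs.

Section DirectLimits.

Variables (F : comNzSemiRingType) (A : nat -> semiAlgType F).
Variable f : forall i, {lrmorphism A i -> A i.+1}.
Variables (L : semiAlgType F) (g : forall i, {lrmorphism A i -> L}).

Lemma cocone_trans (gf : cocone f g) i k (x : A i) :
  g (k + i) (trans_map f i k x) = g i x.
Proof. by elim: k => //= k IH; rewrite gf. Qed.

Section Image.

Variable gf : cocone f g.

(* The cocone is an argument only for the sake of canonical structures: it
   makes the image closed under the operations. *)
Definition limit_image of cocone f g : {pred L} :=
  fun z => `[< exists i, exists x, z = g i x >].

Lemma limit_imageP z :
  reflect (exists i, exists x, z = g i x) (z \in limit_image gf).
Proof. exact: asboolP. Qed.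

Lemma cocone_image_le i m (x : A i) : (i <= m)%N -> exists y, g i x = g m y.
Proof.
by move=> /subnK <-; exists (trans_map f i (m - i) x); rewrite cocone_trans.
Qed.

Lemma limit_image2 z w : z \in limit_image gf -> w \in limit_image gf ->
  exists i (x y : A i), z = g i x /\ w = g i y.
Proof.
move=> /limit_imageP[i [x ->]] /limit_imageP[j [y ->]]; exists (maxn i j).
have [x' ->] := cocone_image_le x (leq_maxl i j).
by have [y' ->] := cocone_image_le y (leq_maxr i j); exists x', y'.
Qed.

Lemma limit_image_closed : GRing.subsemialg_closed (limit_image gf).
Proof.
split.
- by apply/limit_imageP; exists 0%N, 1; rewrite rmorph1.
- split; first by apply/limit_imageP; exists 0%N, 0; rewrite linear0.
  move=> z w hz hw; have [i [x [y [-> ->]]]] := limit_image2 hz hw.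
  by apply/limit_imageP; exists i, (x + y); rewrite linearD.
- move=> a z /limit_imageP[i [x ->]].
  by apply/limit_imageP; exists i, (a *: x); rewrite linearZ.
- move=> z w hz hw; have [i [x [y [-> ->]]]] := limit_image2 hz hw.
  by apply/limit_imageP; exists i, (x * y); rewrite rmorphM.
Qed.

HB.instance Definition _ :=
  GRing.isSubSemiAlgClosed.Build F L (limit_image gf) limit_image_closed.

Record limit_sub : Type :=
  LimitSub { limit_val :> L; _ : limit_val \in limit_image gf }.

HB.instance Definition _ := [isSub for limit_val].
HB.instance Definition _ := [Choice of limit_sub by <:].
HB.instance Definition _ := [SubChoice_isSubSemiAlgebra of limit_sub by <:].

Lemma limit_image_g i (x : A i) : g i x \in limit_image gf.
Proof. by apply/limit_imageP; exists i, x. Qed.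

Definition limit_incl i (x : A i) : limit_sub := LimitSub (limit_image_g x).

Lemma limit_incl_semilinear i : semilinear (@limit_incl i).
Proof.
by split=> [a x|x y]; apply: val_inj; rewrite /= ?linearZ ?linearD.
Qed.

Lemma limit_incl_monoid_morphism i : monoid_morphism (@limit_incl i).
Proof.
by split=> [|x y]; apply: val_inj; rewrite /= ?rmorph1 ?rmorphM.
Qed.

HB.instance Definition _ i := GRing.isSemilinear.Build F (A i) limit_sub *:%R
  (@limit_incl i) (limit_incl_semilinear i).
HB.instance Definition _ i := GRing.isMonoidMorphism.Build (A i) limit_sub
  (@limit_incl i) (limit_incl_monoid_morphism i).

Definition limit_incl_lr i : {lrmorphism A i -> limit_sub} := @limit_incl i.

Lemma limit_incl_cocone : cocone f limit_incl_lr.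
Proof. by move=> i x; apply: val_inj; rewrite /= gf. Qed.

End Image.

Hypothesis lim : direct_limit f g.

(** The image of the cocone is a subalgebra, so the universal property maps [L] into it. Followed by
    the inclusion, this map is the identity by uniqueness. *)
Lemma direct_limit_surj z : exists i x, z = g i x.
Proof.
have [gf univ] := lim.
have [u [uE _]] := univ _ _ (limit_incl_cocone gf).
have [w [_ wE]] := univ _ g gf.
have vL : semilinear (@limit_val gf) by [].
have vM : monoid_morphism (@limit_val gf) by [].
pose b := GRing.isSemilinear.Build F (limit_sub gf) L *:%R _ vL.
pose b' := GRing.isMonoidMorphism.Build (limit_sub gf) L _ vM.
pose V : {lrmorphism limit_sub gf -> L} := HB.pack (@limit_val gf) b b'.
have h1 : V \o u =1 w.
  by apply: (wE [the {lrmorphism L -> L} of V \o u]) => i x; rewrite /= uE.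
have h2 : idfun =1 w by apply: (wE [the {lrmorphism L -> L} of idfun]).
by apply/(limit_imageP gf); rewrite -[z]/(idfun z) h2 -h1; apply: (valP (u z)).
Qed.

(** The map from [L] to the algebra of germs turns equality in the limit into equality at all late
    stages. *)
Lemma direct_limit_eq i (x y : A i) : g i x = g i y ->
  exists k, trans_map f i k x = trans_map f i k y.
Proof.
have [gf univ] := lim; have [u [uE _]] := univ _ _ (to_germ_cocone f).
move=> gxy; apply: to_germ_eq.
by have := congr1 u gxy; rewrite !uE.
Qed.

End DirectLimits.

(** * Matrix units in ultramatricial algebras *)

Section MatrixUnitsOfMatricial.

Variable F : comNzSemiRingType.

Definition mu_spanned (A : semiAlgType F) : Prop :=
  exists (I : finType) (c : I -> nat) (e : I -> I -> A),
    musys c e /\ forall z, mspan c e z.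

Lemma mu_spanned_mx n : mu_spanned 'M[F]_n.+1.
Proof.
exists 'I_n.+1, (fun _ => 0%N), (fun i j => delta_mx i j); split.
  split=> // [i j k _|i j k l njk|]; first exact: mul_delta_mx.
    exact: mul_delta_mx_0.
  by rewrite -mx1_sum_delta.
move=> z; exists (fun i j => z i j) => //.
exact: matrix_sum_delta.
Qed.

Lemma mu_spanned_prod (A B : semiAlgType F) :
  mu_spanned A -> mu_spanned B -> mu_spanned (A * B)%type.
Proof.
move=> [I [c [e [me he]]]] [J [d [b [mb hb]]]].
pose E (u v : I + J) : (A * B)%type :=
  match u, v with
  | inl i, inl j => (e i j, 0)
  | inr i, inr j => (0, b i j)
  | _, _ => 0
  end.
(* Even colours for the first factor and odd ones for the second, so that no two blocks merge. *)
pose cd (u : I + J) := match u with inl i => (c i).*2 | inr j => (d j).*2.+1 end.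
exists (I + J)%type, cd, E.
have sum1 (G : I -> A) : \sum_i ((G i, 0) : A * B) = (\sum_i G i, 0).
  by elim/big_ind2: _ => // x y z t -> ->; congr pair; rewrite addr0.
have sum2 (G : J -> B) : \sum_i ((0, G i) : A * B) = (0, \sum_i G i).
  by elim/big_ind2: _ => // x y z t -> ->; congr pair; rewrite addr0.
split; first split.
- move=> [i|i] [j|j] //= nij; congr pair.
    by rewrite (mu_off me) //; apply: contraNneq nij => ->.
  by rewrite (mu_off mb) //; apply: contraNneq nij => ->.
- have hodd m n : m.*2 <> n.*2.+1.
    by move=> /(congr1 odd); rewrite /= !odd_double.
  move=> [i|i] [j|j] k /= h; try by case: (hodd _ _ h).
  + case: k => k; rewrite ?mulr0 //; congr pair; rewrite /= ?mulr0 //.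
    by apply: (mu_mul me); apply: double_inj.
  + by case: (hodd _ _ (esym h)).
  + case: k => k; rewrite ?mulr0 //; congr pair; rewrite /= ?mulr0 //.
    by apply: (mu_mul mb); apply: double_inj; case: h.
- move=> [i|i] [j|j] [k|k] [l|l] njk; rewrite ?mulr0 ?mul0r //;
    congr pair; rewrite /= ?mulr0 ?mul0r //.
    by apply: (mu_orth me); apply: contraNneq njk => ->.
  by apply: (mu_orth mb); apply: contraNneq njk => ->.
- by rewrite big_sumType /= sum1 sum2 (mu_sum me) (mu_sum mb); congr pair;
    rewrite /= ?addr0 ?add0r.
move=> [z w]; have [x sx ->] := he z; have [y sy ->] := hb w.
exists (fun u v => match u, v with
  | inl i, inl j => x i j | inr i, inr j => y i j | _, _ => 0 end).
  move=> [i|i] [j|j] //= nij; [apply: sx|apply: sy];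
    by apply: contraNneq nij => ->.
rewrite /lin big_sumType /=.
have h1 (G : I -> I -> A) : \sum_i \sum_j ((G i j, 0) : A * B) =
    (\sum_i \sum_j G i j, 0).
  by rewrite -sum1; apply: eq_bigr => i _; rewrite sum1.
have h2 (G : J -> J -> B) : \sum_i \sum_j ((0, G i j) : A * B) =
    (0, \sum_i \sum_j G i j).
  by rewrite -sum2; apply: eq_bigr => i _; rewrite sum2.
rewrite -[LHS](_ : (lin e x, 0) + (0, lin b y) = _); last first.
  by congr pair; rewrite /= ?addr0 ?add0r.
rewrite /lin -h1 -h2; congr (_ + _); apply: eq_bigr => i _; rewrite big_sumType /=.
  rewrite [X in _ = _ + X]big1 ?addr0 => [|j _]; last exact: scaler0.
  by apply: eq_bigr => j _; congr pair; rewrite /= ?scaler0.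
rewrite [X in _ = X + _]big1 ?add0r => [|j _]; last exact: scaler0.
by apply: eq_bigr => j _; congr pair; rewrite /= ?scaler0.
Qed.

Lemma mu_spanned_iso (A B : semiAlgType F) : alg_iso A B ->
  mu_spanned B -> mu_spanned A.
Proof.
case=> f [g fK gK] [I [c [e [me he]]]].
have gD x y : g (x + y) = g x + g y.
  by rewrite -[x in LHS]gK -[y in LHS]gK -linearD fK.
have gZ a x : g (a *: x) = a *: g x.
  by rewrite -[x in LHS]gK -linearZ fK.
have gM x y : g (x * y) = g x * g y.
  by rewrite -[x in LHS]gK -[y in LHS]gK -rmorphM fK.
have g0 : g 0 = 0 by rewrite -(linear0 f) fK.
have g1 : g 1 = 1 by rewrite -(rmorph1 f) fK.
have gS (T : finType) (G : T -> B) : g (\sum_t G t) = \sum_t g (G t).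
  by apply: big_morph.
exists I, c, (fun i j => g (e i j)); split.
  split.
  - by move=> i j nij; rewrite (mu_off me).
  - by move=> i j k cij; rewrite -gM (mu_mul me).
  - by move=> i j k l njk; rewrite -gM (mu_orth me).
  - by rewrite -gS (mu_sum me).
move=> z; have [x sx zE] := he (f z); exists x => //.
rewrite -[LHS]fK zE /lin gS; apply: eq_bigr => i _; rewrite gS.
by apply: eq_bigr => j _; rewrite gZ.
Qed.

Lemma mu_spanned_matricial (A : semiAlgType F) : matricial A -> mu_spanned A.
Proof.
case=> n [s h]; apply: mu_spanned_iso h _; elim: s n => [|m s IH] n /=.
  exact: mu_spanned_mx.
by apply: mu_spanned_prod; [apply: mu_spanned_mx|apply: IH].
Qed.

Hypothesis hF : semifield F.

Lemma torsion_free_matricial (A : semiAlgType F) : matricial A -> torsion_free A.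
Proof.
case=> n [s [f [g fK gK]]].
suff h : torsion_free (matalg F n s).
  move=> a b z nz abz; apply: (h a b (f z)); last by rewrite -!linearZ abz.
  by apply: contraNneq nz => fz0; rewrite -[z]fK fz0 -(linear0 f) fK.
have mx k : torsion_free 'M[F]_k.+1.
  move=> a b z nz abz.
  have [i [j zij]] : exists i j, z i j != 0.
    apply: contra_notP (negP nz) => /forallNP h; apply/eqP/matrixP => i j.
    by have /forallNP/(_ j)/negP := h i; rewrite negbK mxE => /eqP.
  apply: (semifield_scale_inj hF zij).
  by have /matrixP/(_ i j) := abz; rewrite !mxE.
move: {f g fK gK}n; elim: s => [|m s IH] n; first exact: mx.
move=> a b [z w] nzw [abz abw].
have [z0|nz] := eqVneq z 0; last exact: mx nz abz.
apply: (IH m _ _ w) => //; apply: contraNneq nzw => w0.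
by rewrite z0 w0.
Qed.

End MatrixUnitsOfMatricial.

Section Ultramatricial.

Variables (F : comNzSemiRingType) (hF : semifield F).

(** The maps into the limit may kill whole blocks. If [e i i] vanishes, so do its row and column;
    deleting such indices changes neither the span nor the sum of the diagonal. *)
Lemma mspan_nonzero (S : semiAlgType F) (I : finType) (c : I -> nat)
    (e : I -> I -> S) : musys c e ->
  exists (J : finType) (d : J -> nat) (b : J -> J -> S),
    [/\ musys d b, forall j, b j j != 0 & forall z, mspan d b z <-> mspan c e z].
Proof.
move=> me; pose P i := e i i != 0.
exists {i | i \in P}, (fun u => c (val u)), (fun u v => e (val u) (val v)).
have e0l i j : i \notin P -> e i j = 0.
  by rewrite negbK => /eqP eii; rewrite -(mu_mul me (i := i) (j := i)) ?eii ?mul0r.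
have e0r i j : j \notin P -> e i j = 0.
  rewrite negbK => /eqP ejj; have [cij|/(mu_off me)//] := eqVneq (c i) (c j).
  by rewrite -(mu_mul me (i := i) (j := j)) // ejj mulr0.
have restr (G : I -> S) : (forall i, i \notin P -> G i = 0) ->
    \sum_(u : {i | i \in P}) G (val u) = \sum_i G i.
  by move=> hG; rewrite -(big_sub P) [RHS](bigID (mem P)) /= [X in _ + X]big1 ?addr0.
split.
- split=> [u v|u v w|u v w x|].
  + exact: mu_off.
  + exact: mu_mul.
  + by rewrite -val_eqE; apply: (mu_orth me).
  + by rewrite (restr (fun i => e i i)) ?(mu_sum me) // => i; apply: e0l.
- by move=> [i hi].
move=> z; split=> [[x sx ->]|[x sx ->]].
  apply: mspan_sum => u; apply: mspan_sum => v; apply: mspanZ.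
  exact: (mspan_mu me).
exists (fun u v => x (val u) (val v)) => [u v|]; first exact: sx.
rewrite /lin -(restr (fun i => \sum_j x i j *: e i j)) => [|i hi].
  apply: eq_bigr => u _; rewrite -restr // => j hj.
  by rewrite e0r ?scaler0.
by rewrite big1 // => j _; rewrite e0l ?scaler0.
Qed.

Lemma musys_morph (A S : semiAlgType F) (g : {lrmorphism A -> S}) (I : finType)
    (c : I -> nat) (e : I -> I -> A) :
  musys c e -> musys c (fun i j => g (e i j)).
Proof.
move=> me; split.
- by move=> i j nij; rewrite (mu_off me) ?rmorph0.
- by move=> i j k cij; rewrite -rmorphM (mu_mul me).
- by move=> i j k l njk; rewrite -rmorphM (mu_orth me) ?rmorph0.
- by rewrite -linear_sum (mu_sum me) rmorph1.
Qed.

Lemma lin_morph (A S : semiAlgType F) (g : {lrmorphism A -> S}) (I : finType)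
    (e : I -> I -> A) x : lin (fun i j => g (e i j)) x = g (lin e x).
Proof.
rewrite /lin linear_sum; apply: eq_bigr => i _; rewrite linear_sum.
by apply: eq_bigr => j _; rewrite linearZ.
Qed.

Lemma alg_iso_sym (A B : semiAlgType F) : alg_iso A B -> alg_iso B A.
Proof.
case=> f [g fK gK]; apply: (@alg_iso_of_rel _ _ _ (fun b a => b = f a)).
- by move=> b; exists (g b); rewrite gK.
- by move=> a; exists (f a).
- by move=> b a a' -> /(can_inj fK).
- by move=> b b' a -> ->.
- by rewrite rmorph1.
- by move=> b a b' a' -> ->; rewrite rmorphM.
- by move=> b a b' a' -> ->; rewrite linearD.
- by move=> k b a ->; rewrite linearZ.
Qed.

Lemma ultramatricial_mu (S : semiAlgType F) : ultramatricial S ->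
  torsion_free S /\ mu_filtration S.
Proof.
case=> A [f [L [g0 [mA lim /alg_iso_sym[psi psib]]]]].
have [psi' psiK psi'K] := psib; have [gf0 _] := lim.
pose g i : {lrmorphism A i -> S} := [the {lrmorphism A i -> S} of psi \o g0 i].
have gf : cocone f g by move=> i x; rewrite /= gf0.
have surj z : exists i x, z = g i x.
  have [i [x xE]] := direct_limit_surj lim (psi' z).
  by exists i, x; rewrite /= -xE psi'K.
have ker i x y : g i x = g i y -> exists k, trans_map f i k x = trans_map f i k y.
  by move=> /(can_inj psiK); apply: direct_limit_eq.
split.
  move=> a b z nz abz; have [i [x zE]] := surj z.
  (* The equality descends to a finite stage, where the image of [x] is still nonzero because [z]
     is. *)
  have [k] : exists k, trans_map f i k (a *: x) = trans_map f i k (b *: x).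
    by apply: ker; rewrite !linearZ /= -[psi _]/(g i x) -zE.
  rewrite !linearZ /=; apply: (torsion_free_matricial hF (mA (k + i)%N)).
  apply: contraNneq nz => x0.
  by rewrite zE -(cocone_trans gf k x) x0 linear0.
have h i : exists (J : finType) (d : J -> nat) (b : J -> J -> S),
    [/\ musys d b, forall j, b j j != 0 &
        forall z, mspan d b z <-> exists x, z = g i x].
  have [I [c [e [me he]]]] := mu_spanned_matricial (mA i).
  have [J [d [b [mb nb hb]]]] := mspan_nonzero (musys_morph (g i) me).
  exists J, d, b; split=> // z; rewrite hb; split=> [[x sx ->]|[x ->]].
    by exists (lin e x); rewrite lin_morph.
  by have [y sy ->] := he x; exists y; rewrite ?lin_morph.
pose h1 i := projT2 (cid (h i)); pose h2 i := projT2 (cid (h1 i)).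
have hP i := projT2 (cid (h2 i)).
exists (fun i => projT1 (cid (h i))), (fun i => projT1 (cid (h1 i))).
exists (fun i => projT1 (cid (h2 i))); split.
- by move=> i; have [] := hP i.
- by move=> i; have [] := hP i.
- move=> i z; have [_ _ hz] := hP i; have [_ _ hz'] := hP i.+1.
  by move=> /hz[x ->]; apply/hz'; exists (f i x); rewrite gf.
- by move=> z; have [i hi] := surj z; exists i; have [_ _ hz] := hP i; apply/hz.
Qed.

End Ultramatricial.

(** * Functoriality of SK0 *)

Section Differences.

Variable S : pzSemiRingType.

Definition SK0_diff (P Q : fgsp S) : SK0 S :=
  gr_class (M := isocls_monoid S) (isocls P, isocls Q).

Lemma SK0_diffE x : exists P Q, x = SK0_diff P Q.
Proof.
have [[X Y] ->] := qclassE x; have [P ->] := qclassE X; have [Q ->] := qclassE Y.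
by exists P, Q.
Qed.

Lemma SK0_diffP (P Q P' Q' : fgsp S) : SK0_diff P Q = SK0_diff P' Q' <->
  exists K : fgsp S, mod_iso (fgsp_sum (fgsp_sum P Q') K) (fgsp_sum (fgsp_sum P' Q) K).
Proof.
split=> [/gr_classP[k /=]|[K h]].
  have [K ->] := qclassE k; rewrite -/(isocls K) !isoclsDE => /isoclsP h.
  by exists K.
apply/gr_classP; exists (isocls K : isocls_monoid S).
by rewrite /= !isoclsDE; apply/isoclsP.
Qed.

Lemma SK0_diffD (P Q P' Q' : fgsp S) :
  cmD (SK0_diff P Q) (SK0_diff P' Q') = SK0_diff (fgsp_sum P P') (fgsp_sum Q Q').
Proof. by rewrite [LHS]grDE /gr_add /= !isoclsDE. Qed.

Lemma SK0_class_diff (P : fgsp S) : SK0_class P = SK0_diff P (fgsp_zero S).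
Proof. by []. Qed.

End Differences.

Section RelatedModules.

(** A relation in place of a functor: no image has to be singled out, and the converse relation can
    be of the same kind, which yields the inverse on [SK0]. *)
Definition fgsp_corr (S T : pzSemiRingType) (r : fgsp S -> fgsp T -> Prop) : Prop :=
  [/\ forall P, exists Q, r P Q,
      forall P P' Q Q', r P Q -> r P' Q' -> mod_iso P P' -> mod_iso Q Q'
    & forall P P' Q Q', r P Q -> r P' Q' -> r (fgsp_sum P P') (fgsp_sum Q Q')].

Lemma fgsp_corr_diff (S T : pzSemiRingType) (r : fgsp S -> fgsp T -> Prop)
    P1 P2 P1' P2' Q1 Q2 Q1' Q2' : fgsp_corr r ->
  r P1 Q1 -> r P2 Q2 -> r P1' Q1' -> r P2' Q2' ->
  SK0_diff P1 P2 = SK0_diff P1' P2' -> SK0_diff Q1 Q2 = SK0_diff Q1' Q2'.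
Proof.
move=> [rt ri rs] r1 r2 r1' r2' /SK0_diffP[K h]; apply/SK0_diffP.
have [K' rK] := rt K; exists K'.
exact: ri (rs _ _ _ _ (rs _ _ _ _ r1 r2') rK) (rs _ _ _ _ (rs _ _ _ _ r1' r2) rK) h.
Qed.

Lemma SK0_iso_of_corr (S T : pzSemiRingType) (r : fgsp S -> fgsp T -> Prop) :
  fgsp_corr r -> fgsp_corr (fun Q P => r P Q) ->
  r (fgsp_zero S) (fgsp_zero T) -> r (fgsp_regular S) (fgsp_regular T) ->
  SK0_iso S T.
Proof.
move=> rP rP' r0 r1; have [rt _ rs] := rP; have [rt' _ _] := rP'.
pose R x y := exists P1 P2 Q1 Q2,
  [/\ r P1 Q1, r P2 Q2, x = SK0_diff P1 P2 & y = SK0_diff Q1 Q2].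
have Rt x : exists y, R x y.
  have [P1 [P2 ->]] := SK0_diffE x; have [Q1 h1] := rt P1; have [Q2 h2] := rt P2.
  by exists (SK0_diff Q1 Q2), P1, P2, Q1, Q2.
have Rt' y : exists x, R x y.
  have [Q1 [Q2 ->]] := SK0_diffE y; have [P1 h1] := rt' Q1; have [P2 h2] := rt' Q2.
  by exists (SK0_diff P1 P2), P1, P2, Q1, Q2.
have Rf x y y' : R x y -> R x y' -> y = y'.
  move=> [P1 [P2 [Q1 [Q2 [h1 h2 -> ->]]]]] [P1' [P2' [Q1' [Q2' [h1' h2' e ->]]]]].
  exact: (fgsp_corr_diff rP h1 h2 h1' h2' e).
have Ri x x' y : R x y -> R x' y -> x = x'.
  move=> [P1 [P2 [Q1 [Q2 [h1 h2 -> ->]]]]] [P1' [P2' [Q1' [Q2' [h1' h2' -> e]]]]].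
  exact: (fgsp_corr_diff rP' h1 h2 h1' h2' e).
have [f fR] := choice Rt; have [g gR] := choice Rt'.
have Rc P Q : r P Q -> f (SK0_class P) = SK0_class Q.
  move=> h; apply: Rf (fR _) _; rewrite !SK0_class_diff.
  by exists P, (fgsp_zero S), Q, (fgsp_zero T).
exists f; split.
- move=> x y; apply: Rf (fR _) _.
  have [P1 [P2 [Q1 [Q2 [h1 h2 -> ->]]]]] := fR x.
  have [P1' [P2' [Q1' [Q2' [h1' h2' -> ->]]]]] := fR y.
  rewrite !SK0_diffD; do 4 eexists; split; [| |reflexivity|reflexivity].
    exact: rs h1 h1'.
  exact: rs h2 h2'.
- exists g => [x|y]; first exact: Ri (gR _) (fR _).
  exact: Rf (fR _) (gR _).
- exact: Rc.
- move=> y; split=> [[Q ->]|[x [P ->] <-]].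
    by have [P h] := rt' Q; exists (SK0_class P); [exists P|apply: Rc].
  by have [Q h] := rt P; exists Q; apply: Rc.
Qed.

End RelatedModules.

(** Restriction of scalars along [psi], as an alias of [M] that carries [psi] in its type so that a
    second action can be attached to the same monoid. *)
Definition twist (R R' : pzSemiRingType) (psi : {rmorphism R' -> R})
  (M : lSemiModType R) : Type := M.

Section Twist.

Variables (R R' : pzSemiRingType) (psi : {rmorphism R' -> R}) (M : lSemiModType R).
Local Notation twist := (twist psi M).

HB.instance Definition _ := Algebra.Nmodule.on twist.

Definition twist_scale (a : R') (m : twist) : twist := psi a *: (m : M).

Fact twist_scaleA a b m : twist_scale a (twist_scale b m) = twist_scale (a * b) m.
Proof. by rewrite /twist_scale scalerA rmorphM. Qed.
Fact twist_scale0 m : twist_scale 0 m = 0.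
Proof. by rewrite /twist_scale rmorph0 scale0r. Qed.
Fact twist_scale1 : left_id 1 twist_scale.
Proof. by move=> m; rewrite /twist_scale rmorph1 scale1r. Qed.
Fact twist_scaleDr : right_distributive twist_scale +%R.
Proof. by move=> a m n; apply: scalerDr. Qed.
Fact twist_scaleDl m : {morph twist_scale^~ m : a b / a + b}.
Proof. by move=> a b; rewrite /twist_scale rmorphD scalerDl. Qed.

HB.instance Definition _ := GRing.Nmodule_isLSemiModule.Build R' twist
  twist_scaleA twist_scale0 twist_scale1 twist_scaleDr twist_scaleDl.

End Twist.

Section Semilinear.

Variables (R R' : pzSemiRingType) (phi : R -> R').

Definition twisted_iso (M : lSemiModType R) (N : lSemiModType R') : Prop :=
  exists (h : M -> N) (k : N -> M), [/\ cancel h k, cancel k h,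
    {morph h : x y / x + y} & forall a x, h (a *: x) = phi a *: h x].

End Semilinear.

Lemma twisted_iso_sym (R R' : pzSemiRingType) (phi : R -> R') (psi : R' -> R) M N :
  cancel psi phi -> twisted_iso phi M N -> twisted_iso psi N M.
Proof.
move=> psiK [h [k [hK kK hD hZ]]]; exists k, h; split=> // [x y|a x].
  by rewrite -[in LHS](kK x) -[in LHS](kK y) -hD hK.
by rewrite -[in LHS](kK x) -[in LHS](psiK a) -hZ hK.
Qed.

Lemma twisted_iso_eq (R R' : pzSemiRingType) (phi : R -> R') (psi : R' -> R)
    (M M' : lSemiModType R) (N N' : lSemiModType R') :
  cancel psi phi -> twisted_iso phi M N -> twisted_iso phi M' N' ->
  mod_iso M M' -> mod_iso N N'.
Proof.
move=> psiK h1 [h' [k' [hK' kK' hD' hZ']]] /mod_iso_inv[u [v [uK vK]]].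
have [k [h [kK hK kD kZ]]] := twisted_iso_sym psiK h1.
apply: (@mod_isoI _ _ _ (fun x => h' (u (k x))) (fun x => h (v (k' x)))).
- split=> [a x|x y]; first by rewrite kZ linearZ hZ' psiK.
  by rewrite kD linearD hD'.
- by move=> x; rewrite hK' uK kK.
- by move=> x; rewrite hK vK kK'.
Qed.

Lemma twisted_iso_prod (R R' : pzSemiRingType) (phi : R -> R')
    (M M' : lSemiModType R) (N N' : lSemiModType R') :
  twisted_iso phi M N -> twisted_iso phi M' N' ->
  twisted_iso phi (M * M')%type (N * N')%type.
Proof.
move=> [h [k [hK kK hD hZ]]] [h' [k' [hK' kK' hD' hZ']]].
exists (fun x => (h x.1, h' x.2)), (fun x => (k x.1, k' x.2)); split.
- by case=> x y /=; rewrite hK hK'.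
- by case=> x y /=; rewrite kK kK'.
- by move=> x y /=; rewrite hD hD'.
- by move=> a x /=; rewrite hZ hZ'.
Qed.

Lemma twisted_iso_row (R R' : pzSemiRingType) (phi : {rmorphism R -> R'})
    (psi : R' -> R) n : cancel phi psi -> cancel psi phi ->
  twisted_iso phi 'rV[R]_n 'rV[R']_n.
Proof.
move=> phiK psiK; exists (map_mx phi), (map_mx psi); split.
- by move=> x; apply/matrixP => i j; rewrite !mxE phiK.
- by move=> x; apply/matrixP => i j; rewrite !mxE psiK.
- by move=> x y; apply/matrixP => i j; rewrite !mxE rmorphD.
- by move=> a x; apply/matrixP => i j; rewrite !mxE rmorphM.
Qed.

Lemma twisted_iso_twist (R R' : pzSemiRingType) (phi : R -> R')
    (psi : {rmorphism R' -> R}) (M : lSemiModType R) :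
  cancel phi psi -> twisted_iso phi M (twist psi M).
Proof.
move=> phiK; exists id, id; split=> // a x.
by rewrite -[RHS]/(psi (phi a) *: x) phiK.
Qed.

Section Converse.

Variables (S T : pzSemiRingType) (phi : {rmorphism S -> T}).

Definition conv_morph : S^c -> T^c := phi.

Lemma conv_morph_nmod : nmod_morphism conv_morph.
Proof. by split=> [|x y]; [apply: (rmorph0 phi)|apply: (rmorphD phi)]. Qed.

Lemma conv_morph_monoid : monoid_morphism conv_morph.
Proof. by split=> [|x y]; [apply: (rmorph1 phi)|apply: (rmorphM phi)]. Qed.

HB.instance Definition _ := GRing.isNmodMorphism.Build S^c T^c conv_morph
  conv_morph_nmod.
HB.instance Definition _ := GRing.isMonoidMorphism.Build S^c T^c conv_morph
  conv_morph_monoid.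

Definition conv_rmorphism : {rmorphism S^c -> T^c} := conv_morph.

End Converse.

(** Transport along the isomorphism [phi] is restriction of scalars along its inverse [psi], applied
    to [P] and to its complementary summand alike. *)
Lemma twisted_fgsp (S T : pzSemiRingType) (phi : {rmorphism S^c -> T^c})
    (psi : {rmorphism T^c -> S^c}) : cancel phi psi -> cancel psi phi ->
  forall P : fgsp S, exists Q : fgsp T, twisted_iso phi P Q.
Proof.
move=> phiK psiK P; have [n [P' h]] := fgspP P.
suff sp : @strongly_projective_fg T (twist psi P).
  by exists (Fgsp sp); apply: twisted_iso_twist.
exists n, (twist psi P'); apply: (twisted_iso_eq psiK _ _ h).
  by apply: twisted_iso_prod; apply: twisted_iso_twist.
exact: twisted_iso_row psiK.
Qed.

Lemma SK0_iso_of_alg_iso (F : comNzSemiRingType) (S T : semiAlgType F) :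
  alg_iso S T -> SK0_iso S T.
Proof.
case=> phi [psi0 phiK psiK0].
have psiA : nmod_morphism psi0.
  split=> [|x y]; first by rewrite -(rmorph0 phi) phiK.
  by rewrite -[x in LHS]psiK0 -[y in LHS]psiK0 -rmorphD phiK.
have psiM : monoid_morphism psi0.
  split=> [|x y]; first by rewrite -(rmorph1 phi) phiK.
  by rewrite -[x in LHS]psiK0 -[y in LHS]psiK0 -rmorphM phiK.
pose b := GRing.isNmodMorphism.Build T S psi0 psiA.
pose b' := GRing.isMonoidMorphism.Build T S psi0 psiM.
pose psi : {rmorphism T -> S} := HB.pack psi0 b b'.
pose p := conv_rmorphism phi; pose q := conv_rmorphism psi.
have pK : cancel p q by exact: phiK.
have qK : cancel q p by exact: psiK0.
apply: (@SK0_iso_of_corr _ _ (fun P Q => twisted_iso p P Q)).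
- split=> [|P P' Q Q'|P P' Q Q']; first exact: twisted_fgsp pK qK.
    exact: twisted_iso_eq.
  exact: twisted_iso_prod.
- split=> [Q|Q Q' P P' h h'|Q Q' P P']; last exact: twisted_iso_prod.
    have [P h] := twisted_fgsp qK pK Q; exists P.
    exact: twisted_iso_sym pK h.
  exact: (twisted_iso_eq pK (twisted_iso_sym qK h) (twisted_iso_sym qK h')).
- exact: twisted_iso_row pK qK.
- exists p, q; split=> // [x y|a x]; first exact: rmorphD.
  exact: rmorphM.
Qed.

Theorem theorem6p21 (F : comNzSemiRingType) (hF : semifield F)
    (S T : semiAlgType F)
    (hS : ultramatricial S) (hT : ultramatricial T) :
  SK0_iso S T <-> alg_iso S T.
Proof.
split; last exact: SK0_iso_of_alg_iso.
have [tfS mS] := ultramatricial_mu hF hS; have [tfT mT] := ultramatricial_mu hF hT.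
exact: alg_iso_of_SK0_iso.
Qed.
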